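(* Let $k$ be an infinite field and $R=k[x,y,z]$ with the standard grading. Given an integer $m\ge 1$, consider a matrix $$\phi=\begin{bmatrix} x^m & p_1\\ y^m & p_2\\ 0 & p_3\end{bmatrix}$$ with entries in $R$, put $\Delta:=x^mp_2-y^mp_1$, and assume: (a) $p_1,p_2,p_3$ are forms in $R$ of degree $n+\epsilon$, for some integers $1\le n\le m$ and $\epsilon\ge\max\{m-n,1\}$. (b) The ideal $I=I_2(\phi)$ has height $2$. (c) The $(x,y)$-primary component of $I_1(\phi)$ is $(x^m,y^n)$. (d) If $m=n$, then either $\Delta$ or $p_3$ has $z$-degree $\epsilon$. Then: (i) The Rees algebra $\mathcal{R}_R(I)$ is Cohen–Macaulay. (ii) The bihomogeneous defining ideal of $\mathcal{R}_R(I)$ in $R[t_1,t_2,t_3]$ is generated by the defining relations of the symmetric algebra of $I$ together with a determinantal form of bidegree $(\epsilon,2)$.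
   Context: For a matrix $A$ over $R$, $I_t(A)$ denotes the ideal generated by the $t\times t$ minors of $A$. The $z$-degree of a polynomial is its degree as a polynomial in $z$. Let $\Delta_i$ be the (signed) $2$-minor of $\phi$ omitting the $i$th row. The Rees algebra is $\mathcal{R}_R(I)=\bigoplus_{i\ge 0}I^i\simeq R[\Delta_1t,\Delta_2t,\Delta_3t]\subset R[t]$. Its bihomogeneous defining ideal is the kernel of the $R$-algebra map $R[t_1,t_2,t_3]\to R[t]$, $t_i\mapsto \Delta_i t$, where $R[t_1,t_2,t_3]=k[x,y,z,t_1,t_2,t_3]$ is bigraded with $x,y,z$ of bidegree $(1,0)$ and $t_1,t_2,t_3$ of bidegree $(0,1)$. The defining relations of the symmetric algebra of $I$ are $f=x^mt_1+y^mt_2$ and $g=p_1t_1+p_2t_2+p_3t_3$, i.e. the entries of $[t_1\ t_2\ t_3]\cdot\phi$. A determinantal form is a bihomogeneous polynomial obtained as the determinant of a square matrix with entries in $R[t_1,t_2,t_3]$. *)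

(* Defs.v *)
From HB Require Import structures.
From mathcomp Require Import all_boot all_order all_algebra.
From mathcomp Require Import boolp classical_sets cardinality.
From mathcomp Require Import mpoly.

Set Implicit Arguments.
Unset Strict Implicit.
Unset Printing Implicit Defensive.

Import GRing.Theory.
Local Open Scope ring_scope.
Local Open Scope classical_set_scope.

(** * Ideals of a commutative ring, as classical subsets *)

Definition is_ideal (S : comNzRingType) (I : set S) : Prop :=
  [/\ I 0, forall a b, I a -> I b -> I (a + b) & forall a b, I b -> I (a * b)].

Definition ideal_gen (S : comNzRingType) (A : set S) : set S :=
  smallest (@is_ideal S) A.

(* [ideal_pow I 0] is the unit ideal, being generated by the empty product. *)
Definition ideal_pow (S : comNzRingType) (I : set S) (i : nat) : set S :=
  ideal_gen [set z | exists s : seq S,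
    [/\ size s = i, forall x, x \in s -> I x & z = \prod_(x <- s) x]].

Definition is_prime (S : comNzRingType) (P : set S) : Prop :=
  [/\ is_ideal P, ~ P 1 & forall a b, P (a * b) -> P a \/ P b].

Definition is_maximal (S : comNzRingType) (M : set S) : Prop :=
  [/\ is_ideal M, ~ M 1 &
      forall J, is_ideal J -> ~ J 1 -> M `<=` J -> J = M].

Definition radical (S : comNzRingType) (I : set S) : set S :=
  [set a | exists e : nat, I (a ^+ e)].

Definition is_primary (S : comNzRingType) (Q : set S) : Prop :=
  [/\ is_ideal Q, ~ Q 1 & forall a b, Q (a * b) -> Q a \/ radical Q b].

Definition minimal_primary_decomposition (S : comNzRingType) (J : set S)
    (r : nat) (Q : 'I_r -> set S) : Prop :=
  [/\ forall i, is_primary (Q i),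
      J = [set a | forall i, Q i a],
      forall i j, i != j -> radical (Q i) <> radical (Q j) &
      forall i, ~ ([set a | forall j, j != i -> Q j a] `<=` Q i)].

Definition is_primary_component (S : comNzRingType) (J P C : set S) : Prop :=
  exists (r : nat) (Q : 'I_r -> set S),
    minimal_primary_decomposition J Q /\
    exists i, radical (Q i) = P /\ Q i = C.

(** * Height and Krull dimension *)

Definition prime_chain (S : comNzRingType) (d : nat) (C : nat -> set S) : Prop :=
  (forall i, (i <= d)%N -> is_prime (C i)) /\
  (forall i, (i < d)%N -> C i `<` C i.+1).

Definition has_krull_dim (S : comNzRingType) (d : nat) : Prop :=
  (exists C : nat -> set S, prime_chain d C) /\
  (forall e (C : nat -> set S), prime_chain e C -> (e <= d)%N).

Definition prime_has_height (S : comNzRingType) (P : set S) (h : nat) : Prop :=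
  (exists C, prime_chain h C /\ C h = P) /\
  (forall e C, prime_chain e C -> C e = P -> (e <= h)%N).

Definition has_height (S : comNzRingType) (I : set S) (h : nat) : Prop :=
  (exists P, [/\ is_prime P, I `<=` P & prime_has_height P h]) /\
  (forall P h', is_prime P -> I `<=` P -> prime_has_height P h' -> (h <= h')%N).

(** * Cohen-Macaulay rings *)

Definition is_noetherian (S : comNzRingType) : Prop :=
  forall I : set S, is_ideal I -> exists s : seq S, I = ideal_gen [set` s].

Definition regular_sequence (S : comNzRingType) (s : seq S) : Prop :=
  (forall i, (i < size s)%N -> forall a,
     ideal_gen [set` take i s] (s`_i * a) -> ideal_gen [set` take i s] a) /\
  ~ ideal_gen [set` s] 1.

Definition has_depth (S : comNzRingType) (M : set S) (d : nat) : Prop :=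
  (exists s : seq S,
     [/\ regular_sequence s, [set` s] `<=` M & size s = d]) /\
  (forall s : seq S,
     regular_sequence s -> [set` s] `<=` M -> (size s <= d)%N).

Definition is_local_cohen_macaulay (L : comNzRingType) : Prop :=
  is_noetherian L /\
  exists M : set L, (forall N, is_maximal N <-> N = M) /\
    exists d, has_depth M d /\ has_krull_dim L d.

(* [f : S -> L] is the localization of S at the prime P; this determines L up
   to a unique isomorphism over S. *)
Definition is_localization_at (S : comNzRingType) (P : set S)
    (L : comNzRingType) (f : {rmorphism S -> L}) : Prop :=
  [/\ forall s, ~ P s -> exists u, f s * u = 1,
      forall y, exists a s, ~ P s /\ y * f s = f a &
      forall a, f a = 0 -> exists s, ~ P s /\ s * a = 0].

Definition is_cohen_macaulay (S : comNzRingType) : Prop :=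
  is_noetherian S /\
  forall M : set S, is_maximal M ->
  forall (L : comNzRingType) (f : {rmorphism S -> L}),
    is_localization_at M f -> is_local_cohen_macaulay L.

(** * The Rees algebra, as the subring of S[t] of all p with p`_i in I^i *)

Section Rees.
Variables (S : comNzRingType) (I : set S).

Lemma ideal_gen_ideal (A : set S) : is_ideal (ideal_gen A).
Proof.
split=> [|a b Ha Hb|a b Hb] J /= [HJ HA]; have [J0 JD JM] := HJ => //.
- by apply: JD; [apply: Ha | apply: Hb].
- by apply: JM; apply: Hb.
Qed.

Lemma ideal_gen_sub (A J : set S) : is_ideal J -> A `<=` J -> ideal_gen A `<=` J.
Proof. by move=> HJ HA a; apply. Qed.

Lemma sub_ideal_gen (A : set S) : A `<=` ideal_gen A.
Proof. by move=> a Ha J /= [_]; apply. Qed.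

Lemma ideal_pow0 (a : S) : ideal_pow I 0 a.
Proof.
have [_ _ HM] := ideal_gen_ideal [set z | exists s : seq S,
    [/\ size s = 0%N, forall x, x \in s -> I x & z = \prod_(x <- s) x]].
rewrite -[a]mulr1; apply: HM; apply: sub_ideal_gen.
by exists [::]; rewrite big_nil.
Qed.

Lemma ideal_powM i j (a b : S) :
  ideal_pow I i a -> ideal_pow I j b -> ideal_pow I (i + j) (a * b).
Proof.
have [H0 HD HM] := ideal_gen_ideal [set z | exists s : seq S,
    [/\ size s = (i + j)%N, forall x, x \in s -> I x & z = \prod_(x <- s) x]].
move=> Ha Hb; move: a Ha.
apply: (@ideal_gen_sub _ [set a | ideal_pow I (i + j) (a * b)]).
  split=> /= [|x y Hx Hy|x y Hy]; first by rewrite mul0r.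
    by rewrite mulrDl; apply: HD.
  by rewrite -mulrA; apply: HM.
move=> _ /= [s [ss Hs ->]]; move: b Hb.
apply: (@ideal_gen_sub _
  [set b | ideal_pow I (i + j) (\prod_(x <- s) x * b)]).
  split=> /= [|x y Hx Hy|x y Hy]; first by rewrite mulr0.
    by rewrite mulrDr; apply: HD.
  by rewrite mulrCA; apply: HM.
move=> _ /= [u [su Hu ->]]; apply: sub_ideal_gen.
exists (s ++ u); rewrite size_cat ss su big_cat; split=> // x.
by rewrite mem_cat => /orP[/Hs|/Hu].
Qed.

Definition rees_pred : {pred {poly S}} :=
  fun p => `[< forall i, ideal_pow I i p`_i >].

Fact rees_subring_closed : subring_closed rees_pred.
Proof.
split=> [|p q /asboolP Hp /asboolP Hq|p q /asboolP Hp /asboolP Hq];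
  apply/asboolP => i.
- case: i => [|i]; first exact: ideal_pow0.
  by rewrite coef1; have [] := ideal_gen_ideal [set z | exists s : seq S,
    [/\ size s = i.+1, forall x, x \in s -> I x & z = \prod_(x <- s) x]].
- have [_ HD HM] := ideal_gen_ideal [set z | exists s : seq S,
    [/\ size s = i, forall x, x \in s -> I x & z = \prod_(x <- s) x]].
  rewrite coefB -mulN1r; apply: HD; first exact: Hp.
  by apply: HM; apply: Hq.
- have [H0 HD _] := ideal_gen_ideal [set z | exists s : seq S,
    [/\ size s = i, forall x, x \in s -> I x & z = \prod_(x <- s) x]].
  rewrite coefM; elim/big_ind: _ => // j _.
  have {1}-> : i = (j + (i - j))%N by rewrite subnKC // -ltnS.
  exact: ideal_powM.
Qed.

HB.instance Definition _ :=
  GRing.isSubringClosed.Build {poly S} rees_pred rees_subring_closed.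

Record rees_algebra : Type :=
  ReesElt { rees_val :> {poly S}; _ : rees_val \in rees_pred }.

HB.instance Definition _ := [isSub for rees_val].
HB.instance Definition _ := [Choice of rees_algebra by <:].
HB.instance Definition _ :=
  [SubChoice_isSubComNzRing of rees_algebra by <:].
End Rees.

(** * Minors *)

Definition is_minor (S : comNzRingType) (a b : nat) (A : 'M[S]_(a, b)) (t : nat)
    (d : S) : Prop :=
  exists (r : 'I_t -> 'I_a) (c : 'I_t -> 'I_b),
    [/\ {homo r : i j / (i < j)%N}, {homo c : i j / (i < j)%N} &
        d = \det (mxsub r c A)].

Definition minor_ideal (S : comNzRingType) (a b : nat) (A : 'M[S]_(a, b))
    (t : nat) : set S :=
  ideal_gen (is_minor A t).

(** * The setting: R = k[x,y,z] and R[t1,t2,t3] *)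

Notation ord3_0 := (@Ordinal 3 0 isT).
Notation ord3_1 := (@Ordinal 3 1 isT).
Notation ord3_2 := (@Ordinal 3 2 isT).

Section Setting.
Variable k : fieldType.
Local Notation R := {mpoly k[3]}.
Local Notation T := {mpoly {mpoly k[3]}[3]}.

Definition var_x : R := 'X_ord3_0.
Definition var_y : R := 'X_ord3_1.

Definition z_degree (p : R) : nat := \max_(mu <- msupp p) mu ord3_2.

Definition phi_mx (m : nat) (p1 p2 p3 : R) : 'M[R]_(3, 2) :=
  \matrix_(i, j)
    if j == ord0 then [:: var_x ^+ m; var_y ^+ m; 0]`_i
    else [:: p1; p2; p3]`_i.

Definition signed_minor (phi : 'M[R]_(3, 2)) (i : 'I_3) : R :=
  (-1) ^+ i * \det (row' i phi).

(* The R-algebra map R[t1,t2,t3] -> R[t] with t_i |-> Delta_i t. *)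
Definition rees_map (phi : 'M[R]_(3, 2)) : T -> {poly R} :=
  mmap (@polyC R) (fun i => signed_minor phi i *: 'X).

Definition rees_ideal (phi : 'M[R]_(3, 2)) : set T :=
  [set F | rees_map phi F = 0].

Definition sym_relation (phi : 'M[R]_(3, 2)) (j : 'I_2) : T :=
  ((\row_(i < 3) 'X_i) *m map_mx (@mpolyC 3 R) phi) ord0 j.

(* The zero polynomial is bihomogeneous of every bidegree. *)
Definition is_bihomog (d e : nat) (F : T) : Prop :=
  F \is e.-homog /\ forall mu, F@_mu \is d.-homog.

Definition is_determinantal_form (d e : nat) (F : T) : Prop :=
  [/\ F != 0, is_bihomog d e F &
      exists (N : nat) (A : 'M[T]_N), F = \det A].

End Setting.

(* Main.v *)
From HB Require Import structures.
Require Import Defs.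
From mathcomp Require Import all_boot all_order all_algebra.
From mathcomp Require Import boolp classical_sets cardinality.
From mathcomp Require Import mpoly ring.

(** By (c) one can write [p_i = a_i x^m + b_i y^n], so that [f] and [g] are obtained by
    applying the matrix with rows [(t1, y^(m-n) t2)] and [(sum a_i t_i, sum b_i t_i)] to
    [(x^m, y^n)].  Let [h] be its determinant; (c) and (d) amount to [h] not lying in
    [(x, y)].  The ideal [J = (f, g, h)] is generated by the 2-minors of a 3 x 2 matrix.
    Hence, as soon as [J] contains a regular sequence of length 2 modulo [q], the
    syzygies of [(f, g, h)] modulo [q] are spanned by the columns of that matrix, and
    every regular element [q] is then regular modulo [J].

    Taking [q = x], whose hypothesis holds because [h] is not in [(x, y)], [x] is regular
    modulo [J].  As [p3] and [Delta] have no common factor, the Rees ideal is generated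
    by [f] and [g] once [x] is inverted, so it equals [J].

    For Cohen-Macaulayness, a Nagata change of coordinates turns [R[t1, t2, t3]] into
    [B[u, v]], with [B] a polynomial ring in four variables, in such a way that [J]
    contains a polynomial monic in [u] over [B] and one monic in [v] over [B[u]].  Thus
    the Rees algebra is integral over [B], which bounds the dimensions of its local rings
    by 4, and a maximal regular sequence of [B] inside the contraction of a maximal ideal
    stays regular modulo [J], again by the statement on syzygies. *)

Set Implicit Arguments.
Unset Strict Implicit.
Unset Printing Implicit Defensive.

Import GRing.Theory.
Local Open Scope ring_scope.
Local Open Scope classical_set_scope.

(** * Ideals, regular sequences and prime chains *)

(** Modulo [(x, y)], [h] is a quadratic form in the [t_i]. If [n < m], its part with [y^(m-n)]
    vanishes; were the form zero, all [b_i] would lie in [(x, y)], so [I_1(phi)] would lie in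
    [(x^m) + y^n (x, y)] and its component could not contain [y^n]. If [m = n], its coefficients
    are, up to sign, those of [p3] and [Delta] written as forms in [x^m] and [y^m]; were they all
    zero modulo [(x, y)], both z-degrees would drop below [epsilon]. The height condition is used
    through primes of height one: none contains all the 2-minors. This gives [p3 <> 0], the
    regularity of [Delta] modulo [p3], and that [x] does not divide both [p1] and [p3]. Such primes
    come from a form of the principal ideal theorem, which rests on the same change of coordinates
    as the Cohen-Macaulay property. Of the two monic polynomials, up to units, one is the transform
    of [f]; the other comes from the norm of [g] modulo [f], a determinant that is again a
    combination of [f] and [g]. *)

Section Ideals.
Variable S : comNzRingType.
Implicit Types (I J P : set S) (s : seq S) (a b c q : S).

Lemma ideal0 I : is_ideal I -> I 0.
Proof. by case. Qed.

Lemma idealD I a b : is_ideal I -> I a -> I b -> I (a + b).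
Proof. by case=> _ + _; apply. Qed.

Lemma idealM I a b : is_ideal I -> I b -> I (a * b).
Proof. by case=> _ _; apply. Qed.

Lemma idealMr I a b : is_ideal I -> I a -> I (a * b).
Proof. by rewrite mulrC; apply: idealM. Qed.

Lemma idealN I a : is_ideal I -> I a -> I (- a).
Proof. by rewrite -mulN1r; apply: idealM. Qed.

Lemma idealB I a b : is_ideal I -> I a -> I b -> I (a - b).
Proof. by move=> HI Ha Hb; apply: idealD => //; apply: idealN. Qed.

Lemma idealBr I a b : is_ideal I -> I (a - b) -> I b -> I a.
Proof. by move=> HI Hab Hb; rewrite -[a](subrK b); apply: idealD. Qed.

Lemma ideal_sum I (T : Type) (r : seq T) (Q : pred T) (F : T -> S) :
  is_ideal I -> (forall i, Q i -> I (F i)) -> I (\sum_(i <- r | Q i) F i).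
Proof.
move=> HI HF; elim/big_rec: _ => [|i x Qi Hx]; first exact: ideal0.
by apply: idealD => //; apply: HF.
Qed.

Lemma is_ideal0 : is_ideal [set 0 : S].
Proof.
by split=> [|a b /= -> ->|a b /= ->]; rewrite /= ?addr0 ?mulr0.
Qed.

(** Working relative to an ideal, by congruences, replaces quotient rings throughout the
    development. *)
Definition addgen I q : set S := [set a | exists c, I (a - c * q)].

Lemma addgen_ideal I q : is_ideal I -> is_ideal (addgen I q).
Proof.
move=> HI; split=> [|a b [c Hc] [d Hd]|a b [c Hc]].
- by exists 0; rewrite mul0r subr0; apply: ideal0.
- exists (c + d); have -> : a + b - (c + d) * q = a - c * q + (b - d * q) by ring.
  exact: idealD.
- exists (a * c); have -> : a * b - a * c * q = a * (b - c * q) by ring.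
  exact: idealM.
Qed.

Lemma sub_addgen I q : I `<=` addgen I q.
Proof. by move=> a Ha; exists 0; rewrite mul0r subr0. Qed.

Lemma addgen_mem I q : is_ideal I -> addgen I q q.
Proof. by move=> HI; exists 1; rewrite mul1r subrr; apply: ideal0. Qed.

Lemma addgen_min I J q : is_ideal J -> I `<=` J -> J q -> addgen I q `<=` J.
Proof.
move=> HJ IJ Jq a [c /IJ Hc]; apply: (idealBr HJ Hc).
exact: idealM.
Qed.

Lemma addgen0E q : addgen [set 0] q = [set a | exists c, a = c * q].
Proof.
apply/seteqP; split=> a [c Hc]; exists c; last by rewrite /= Hc subrr.
exact: subr0_eq.
Qed.

Definition addgens I s : set S := foldl addgen I s.

Lemma addgens_ideal I s : is_ideal I -> is_ideal (addgens I s).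
Proof. by elim: s I => //= q s IH I HI; apply/IH/addgen_ideal. Qed.

Lemma sub_addgens I s : I `<=` addgens I s.
Proof.
elim: s I => [|q s IH] I //=; apply: subset_trans (IH _).
exact: sub_addgen.
Qed.

Lemma addgens_min I J s :
  is_ideal J -> I `<=` J -> [set` s] `<=` J -> addgens I s `<=` J.
Proof.
move=> HJ; elim: s I => [|q s IH] I IJ sJ //=; apply: IH.
  by apply: addgen_min => //; apply: sJ; rewrite /= mem_head.
by move=> x xs; apply: sJ; rewrite /= in_cons xs orbT.
Qed.

Lemma addgens_mem I s : is_ideal I -> [set` s] `<=` addgens I s.
Proof.
elim: s I => [|q s IH] I HI //= x /=; rewrite in_cons => /orP[/eqP ->|xs].
  by apply/sub_addgens/addgen_mem.
by apply: IH => //; apply: addgen_ideal.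
Qed.

Lemma addgens_rcons I s q : addgens I (rcons s q) = addgen (addgens I s) q.
Proof. by rewrite /addgens foldl_rcons. Qed.

Lemma ideal_genE s : ideal_gen [set` s] = addgens [set 0] s.
Proof.
apply/seteqP; split.
  by apply: ideal_gen_sub; [apply/addgens_ideal/is_ideal0|exact/addgens_mem/is_ideal0].
apply: addgens_min; [exact: ideal_gen_ideal| |exact: sub_ideal_gen].
by move=> _ ->; exact: (ideal0 (ideal_gen_ideal _)).
Qed.

Lemma ideal_gen2P f g a :
  ideal_gen [set f; g] a <-> exists u v, a = u * f + v * g.
Proof.
have -> : [set f; g] = [set` [:: f; g]].
  apply/seteqP; split=> x /=; rewrite !inE.
    by case=> ->; rewrite eqxx ?orbT.
  by case/orP=> /eqP ->; [left|right].
rewrite ideal_genE /= addgen0E; split=> [[v [u E]]|[u [v ->]]].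
  by exists u, v; rewrite -E subrK.
by exists v, u; rewrite addrK.
Qed.

Lemma ideal_gen3P f g h a :
  ideal_gen [set f; g; h] a <-> exists u v w, a = u * f + v * g + w * h.
Proof.
have -> : [set f; g; h] = [set` [:: f; g; h]].
  apply/seteqP; split=> x /=; rewrite !inE.
    by case=> [[]|] ->; rewrite eqxx ?orbT.
  by case/or3P=> /eqP ->; [left; left|left; right|right].
rewrite ideal_genE /= addgen0E; split=> [[w [v [u E]]]|[u [v [w ->]]]].
  by exists u, v, w; rewrite -E !subrK.
by exists w, v, u; rewrite !addrK.
Qed.

(** Nonzerodivisors modulo [I], without properness: everything is regular modulo the unit ideal.
    Properness of a regular sequence is obtained at the end from the maximal ideal containing it. *)
Definition regmod I q := forall a, I (q * a) -> I a.

Fixpoint relreg I s : Prop :=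
  if s is q :: s' then regmod I q /\ relreg (addgen I q) s' else True.

Lemma relreg_rcons I s q :
  relreg I (rcons s q) <-> relreg I s /\ regmod (addgens I s) q.
Proof.
elim: s I => [|p s IH] I /=; first by split=> [[]|[]].
by rewrite IH /=; split=> [[? []]|[[]]].
Qed.

Lemma relregP s :
  relreg [set 0] s <->
  forall i, (i < size s)%N -> forall a,
    ideal_gen [set` take i s] (s`_i * a) -> ideal_gen [set` take i s] a.
Proof.
elim/last_ind: s => [|s q IH]; first by split.
rewrite relreg_rcons IH; split=> [[H Hq] i|H].
  rewrite size_rcons ltnS leq_eqVlt => /orP[/eqP ->|lt_is].
    by rewrite nth_rcons ltnn eqxx -cats1 take_size_cat // ideal_genE.
  by rewrite nth_rcons lt_is -cats1 takel_cat ?(ltnW lt_is) //; apply: H.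
split=> [i lt_is|].
  have := H i; rewrite size_rcons ltnS (ltnW lt_is) nth_rcons lt_is.
  by rewrite -cats1 takel_cat ?(ltnW lt_is) //; apply.
have := H (size s); rewrite size_rcons ltnSn nth_rcons ltnn eqxx.
by rewrite -cats1 take_size_cat // ideal_genE; apply.
Qed.

Lemma prime_ideal P : is_prime P -> is_ideal P.
Proof. by case. Qed.

Lemma primeX P a e : is_prime P -> P (a ^+ e) -> P a.
Proof.
move=> [HP P1 PM]; elim: e => [|e IH]; first by rewrite expr0 => /P1.
by rewrite exprS => /PM[].
Qed.

(** An ideal maximal among those containing [I] and avoiding [W] is prime: if neither [a] nor [b] is
    in it, [W] meets both enlarged ideals, and the product of the two elements of [W] falls into the
    ideal once [a * b] does. *)
Lemma krull_prime I (W : set S) :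
  is_ideal I -> W 1 -> (forall a b, W a -> W b -> W (a * b)) ->
  (forall a, I a -> ~ W a) ->
  exists P, [/\ is_prime P, I `<=` P & forall a, P a -> ~ W a].
Proof.
move=> HI W1 WM IW.
(* Zorn is applied to the sets whose union with [I] is an ideal avoiding [W], so that the empty
   chain, with empty union, is accounted for by [I] itself. *)
pose good (X : set S) := is_ideal (X `|` I) /\ forall a, (X `|` I) a -> ~ W a.
have [F FG tF|A [[HA AW] maxA]] := @Zorn_bigcup S good.
  split; last first.
    by move=> a [[X /FG [_ XW]] Xa|/IW //]; apply: XW; left.
  split; first by right; apply: ideal0.
  - move=> a b [[X FX Xa]|Ia] [[Y FY Yb]|Ib].
    + have [Z FZ [Za Zb]] : exists2 Z, F Z & Z a /\ Z b.
        by have [/(_ _ Xa)|/(_ _ Yb)] := tF _ _ FX FY; [exists Y|exists X].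
      have [HZ _] := FG _ FZ.
      by case: (idealD HZ (or_introl Za) (or_introl Zb)); [left; exists Z|right].
    + have [HX _] := FG _ FX.
      by case: (idealD HX (or_introl Xa) (or_intror Ib)); [left; exists X|right].
    + have [HY _] := FG _ FY.
      by case: (idealD HY (or_intror Ia) (or_introl Yb)); [left; exists Y|right].
    + by right; apply: idealD.
  - move=> a b [[X FX Xb]|Ib]; last by right; apply: idealM.
    have [HX _] := FG _ FX.
    by case: (idealM a HX (or_introl Xb)); [left; exists X|right].
pose P := A `|` I.
have maxP J : is_ideal J -> P `<=` J -> (forall a, J a -> ~ W a) -> J `<=` P.
  move=> HJ PJ JW x Jx; have AJ : A `<=` J by move=> y Ay; apply: PJ; left.
  have IJ : I `<=` J by move=> y Iy; apply: PJ; right.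
  have gJ : good J.
    have -> : good J = (is_ideal J /\ forall a, J a -> ~ W a) by rewrite /good setUidl.
    by [].
  apply: contrapT => nPx; apply: (maxA J _ gJ); split=> // JA.
  by apply: nPx; left; apply: JA.
have HP : is_ideal P := HA.
have step x : ~ P x -> exists w c, W w /\ P (w - c * x).
  move=> nPx; apply: contrapT => nex; apply: nPx.
  apply: (maxP (addgen P x)); [exact: addgen_ideal|exact: sub_addgen| |exact: addgen_mem].
  by move=> w [c Hc] Ww; apply: nex; exists w, c.
exists P; split=> //; last by move=> a Ia; right.
split=> // [/AW /(_ W1) //|a b Pab].
apply: contrapT => /not_orP[/step [w [c [Ww Hc]]] /step [v [d [Wv Hd]]]].
apply: (AW (w * v)); last exact: WM.
have -> : w * v = (w - c * a) * v + c * a * (v - d * b) + c * d * (a * b) by ring.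
apply: (idealD HP); last exact: idealM.
by apply: idealD => //; [apply: idealMr|apply: idealM].
Qed.

Lemma maximal_prime P : is_maximal P -> is_prime P.
Proof.
move=> [HP P1 maxP]; split=> // a b Pab; apply: contrapT => /not_orP[nPa nPb].
have [c Hc] : addgen P a 1.
  apply: contrapT => n1; apply: nPa.
  by rewrite -(maxP _ (addgen_ideal a HP) n1 (@sub_addgen _ _)); apply: addgen_mem.
apply: nPb; have -> : b = (1 - c * a) * b + c * (a * b) by ring.
by apply: idealD => //; [apply: idealMr|apply: idealM].
Qed.

(** The source of the inequality between depth and dimension. As [q] is regular modulo the ideal of
    [s], that ideal contains no [v * q ^+ e] with [v] outside [P]; a prime avoiding all of these
    lies in [P] and misses [q], and the induction continues below it. *)
Lemma relreg_prime_chain I s P :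
  is_ideal I -> relreg I s -> is_prime P -> I `<=` P -> [set` s] `<=` P ->
  exists C, [/\ prime_chain (size s) C, C (size s) = P & I `<=` C 0%N].
Proof.
move=> HI; elim/last_ind: s P => [|s q IH] P.
  by move=> _ HP IP _; exists (fun=> P); split=> //; split.
rewrite relreg_rcons => -[regs regq] HP IP sP.
have sP' : [set` s] `<=` P by move=> x xs; apply: sP; rewrite /= mem_rcons in_cons xs orbT.
have Pq : P q by apply: sP; rewrite /= mem_rcons mem_head.
pose W := [set w | exists v e, ~ P v /\ w = v * q ^+ e].
have regX e a : addgens I s (q ^+ e * a) -> addgens I s a.
  by elim: e a => [|e IHe] a; rewrite ?expr0 ?mul1r // exprS -mulrA => /regq /IHe.
have HIs := addgens_ideal s HI.
have HPi := prime_ideal HP.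
have [|a b [v [e [nv ->]]] [w [d [nw ->]]]|a Ia [v [e [nv Ea]]]|P' [HP' IP' P'W]] :=
    @krull_prime (addgens I s) W HIs.
- by exists 1, 0%N; rewrite mul1r expr0; split=> //; case: HP.
- exists (v * w), (e + d)%N; rewrite exprD; split; last by ring.
  by have [_ _ PM] := HP; move=> /PM[].
- apply: nv; apply: (addgens_min HPi IP sP'); apply: (regX e).
  by rewrite mulrC -Ea.
have P'P : P' `<=` P.
  move=> x P'x; apply: contrapT => nPx; apply: (P'W x P'x).
  by exists x, 0%N; rewrite mulr1.
have nP'q : ~ P' q.
  move=> /P'W; apply; exists 1, 1%N; rewrite mul1r; split=> //; by case: HP.
have [C [[Cp Cs] CP' IC]] := IH P' regs HP' (subset_trans (@sub_addgens _ _) IP')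
  (subset_trans (addgens_mem HI) IP').
exists (fun i => if (i <= size s)%N then C i else P); rewrite size_rcons ltnn.
split=> //; split=> i lti; first by case: leqP => // /Cp.
rewrite -ltnS lti; case: ltnP => [|le]; first exact: Cs.
have -> : i = size s by apply/eqP; rewrite eqn_leq le -ltnS lti.
by rewrite CP'; split=> // /(_ _ Pq).
Qed.

End Ideals.

(** * Syzygies of the minors of a 3 x 2 matrix *)

Section HilbertBurch.
Variables (S : comNzRingType) (t c a b X Y : S).
Local Notation f := (t * X + c * Y).
Local Notation g := (a * X + b * Y).
Local Notation h := (t * b - c * a).
Implicit Types (I : set S) (q r : S).

(** Up to sign, [f], [g], [h] are the 2-minors of the matrix with columns [(b, -c, -X)] and
    [(-a, t, -Y)], which are also relations between them. The base ideal [I] lets the same lemmas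
    apply modulo part of a regular sequence. *)
Definition hb_ideal I : set S :=
  [set z | exists u v w, I (z - (u * f + v * g + w * h))].

Lemma hb_ideal_ideal I : is_ideal I -> is_ideal (hb_ideal I).
Proof.
move=> HI; split=> [|x y [u [v [w Hx]]] [u' [v' [w' Hy]]]|x y [u [v [w Hy]]]].
- by exists 0, 0, 0; rewrite !mul0r !addr0 subr0; apply: ideal0.
- exists (u + u'), (v + v'), (w + w').
  have -> : x + y - ((u + u') * f + (v + v') * g + (w + w') * h) =
    (x - (u * f + v * g + w * h)) + (y - (u' * f + v' * g + w' * h)) by ring.
  exact: idealD.
- exists (x * u), (x * v), (x * w).
  have -> : x * y - (x * u * f + x * v * g + x * w * h) =
    x * (y - (u * f + v * g + w * h)) by ring.
  exact: idealM.
Qed.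

Lemma addgen_hb_ideal I q :
  is_ideal I -> addgen (hb_ideal I) q = hb_ideal (addgen I q).
Proof.
move=> HI; apply/seteqP; split=> z.
  by move=> [e [u [v [w H]]]]; exists u, v, w, e; rewrite addrAC.
by move=> [u [v [w [e H]]]]; exists e, u, v, w; rewrite addrAC.
Qed.

(* Each 2-minor of the matrix multiplies every syzygy into the column span. *)
Lemma minor_mul_syzygy I r x y z :
  is_ideal I -> hb_ideal [set 0] r -> I (x * f + y * g + z * h) ->
  exists w1 w2, [/\ I (r * x - (b * w1 - a * w2)), I (r * y - (t * w2 - c * w1))
    & I (r * z + (X * w1 + Y * w2))].
Proof.
move=> HI [u [v [w /subr0_eq ->]]] Hs.
(* Cramer's rule: the summands in [u], [v], [w] solve the pairs of rows whose minors are [f], [g],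
   [h], and the row left out in each case is controlled by the syzygy. *)
exists (u * (- (Y * y) - t * z) + v * (Y * x - a * z) + w * (t * x + a * y)).
exists (u * (X * y - c * z) + v * (- (X * x) - b * z) + w * (c * x + b * y)).
set s := x * f + y * g + z * h in Hs.
have tr p q : I p -> q = p -> I q by move=> Ip ->.
by split; [apply: (tr (u * s))|apply: (tr (v * s))|apply: (tr (w * s))];
  (try exact: idealM); rewrite /s; ring.
Qed.

(** Both [r1] and [r2] bring the syzygy into the column span, with coefficients [w] and [v]. The
    columns are independent modulo [I], because [r1] is a regular combination of the minors, so
    [r2 w] and [r1 v] agree. Regularity of [r2] modulo [r1] then makes [w] divisible by [r1], which
    cancels. *)
Lemma hb_syzygy I r1 r2 x y z :
  is_ideal I -> hb_ideal [set 0] r1 -> hb_ideal [set 0] r2 ->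
  regmod I r1 -> regmod (addgen I r1) r2 -> I (x * f + y * g + z * h) ->
  exists w1 w2, [/\ I (x - (b * w1 - a * w2)), I (y - (t * w2 - c * w1))
    & I (z + (X * w1 + Y * w2))].
Proof.
move=> HI J1 J2 reg1 reg2 Hs.
have [w1 [w2 [Hx Hy Hz]]] := minor_mul_syzygy HI J1 Hs.
have [v1 [v2 [Kx Ky Kz]]] := minor_mul_syzygy HI J2 Hs.
pose d1 := r2 * w1 - r1 * v1; pose d2 := r2 * w2 - r1 * v2.
have Dx : I (b * d1 - a * d2).
  have -> : b * d1 - a * d2 = r1 * (r2 * x - (b * v1 - a * v2))
    - r2 * (r1 * x - (b * w1 - a * w2)) by rewrite /d1 /d2; ring.
  by apply: idealB => //; apply: idealM.
have Dy : I (t * d2 - c * d1).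
  have -> : t * d2 - c * d1 = r1 * (r2 * y - (t * v2 - c * v1))
    - r2 * (r1 * y - (t * w2 - c * w1)) by rewrite /d1 /d2; ring.
  by apply: idealB => //; apply: idealM.
have Dz : I (X * d1 + Y * d2).
  have -> : X * d1 + Y * d2 = r2 * (r1 * z + (X * w1 + Y * w2))
    - r1 * (r2 * z + (X * v1 + Y * v2)) by rewrite /d1 /d2; ring.
  by apply: idealB => //; apply: idealM.
have [Id1 Id2] : I d1 /\ I d2.
  case: J1 => u [v [w /subr0_eq Er1]].
  split; apply: reg1; rewrite Er1.
    have -> : (u * f + v * g + w * h) * d1 =
      (u * t + v * a) * (X * d1 + Y * d2) + (v * Y + w * t) * (b * d1 - a * d2)
      + (w * a - u * Y) * (t * d2 - c * d1) by ring.
    by do 2?apply: idealD => //; apply: idealM.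
  have -> : (u * f + v * g + w * h) * d2 =
    (u * c + v * b) * (X * d1 + Y * d2) + (w * c - v * X) * (b * d1 - a * d2)
    + (u * X + w * b) * (t * d2 - c * d1) by ring.
  by do 2?apply: idealD => //; apply: idealM.
have [e1 He1] : addgen I r1 w1 by apply: reg2; exists v1; rewrite [v1 * _]mulrC.
have [e2 He2] : addgen I r1 w2 by apply: reg2; exists v2; rewrite [v2 * _]mulrC.
exists e1, e2; split; apply: reg1.
- have -> : r1 * (x - (b * e1 - a * e2)) = r1 * x - (b * w1 - a * w2)
    + b * (w1 - e1 * r1) - a * (w2 - e2 * r1) by ring.
  by apply: idealB => //; [apply: idealD => //|]; apply: idealM.
- have -> : r1 * (y - (t * e2 - c * e1)) = r1 * y - (t * w2 - c * w1)
    + t * (w2 - e2 * r1) - c * (w1 - e1 * r1) by ring.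
  by apply: idealB => //; [apply: idealD => //|]; apply: idealM.
- have -> : r1 * (z + (X * e1 + Y * e2)) = r1 * z + (X * w1 + Y * w2)
    - X * (w1 - e1 * r1) - Y * (w2 - e2 * r1) by ring.
  by apply: idealB => //; [apply: idealB => //|]; apply: idealM.
Qed.

(** A relation [q z = x f + y g + w h] is a syzygy modulo [q], hence a combination of the columns up
    to multiples of [q]. The columns contribute zero, and [q] cancels from the rest. *)
Lemma hb_regmod I q r1 r2 :
  is_ideal I -> hb_ideal [set 0] r1 -> hb_ideal [set 0] r2 ->
  regmod I q -> relreg (addgen I q) [:: r1; r2] -> regmod (hb_ideal I) q.
Proof.
move=> HI J1 J2 regq [reg1 [reg2 _]] z [x [y [w Hz]]].
have [|w1 [w2 [[x' Hx] [y' Hy] [w' Hw]]]] :=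
    @hb_syzygy (addgen I q) r1 r2 (- x) (- y) (- w) (addgen_ideal q HI) J1 J2 reg1 reg2.
  exists (- z); rewrite (_ : _ - _ = q * z - (x * f + y * g + w * h)) //.
  ring.
exists (- x'), (- y'), (- w'); apply: regq.
have -> : q * (z - (- x' * f + - y' * g + - w' * h)) =
  (q * z - (x * f + y * g + w * h)) - (f * (- x - (b * w1 - a * w2) - x' * q)
   + g * (- y - (t * w2 - c * w1) - y' * q)
   + h * (- w + (X * w1 + Y * w2) - w' * q)) by ring.
apply: idealB => //; apply: idealD => //; last exact: idealM.
by apply: idealD => //; apply: idealM.
Qed.

End HilbertBurch.

(** * Ideals and regular sequences along ring morphisms *)

Section Transport.
Variables (S L : comNzRingType) (f : {rmorphism S -> L}).
Implicit Types (I : set S) (K : set L) (s : seq S).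

Lemma preimage_ideal K : is_ideal K -> is_ideal (f @^-1` K).
Proof.
move=> HK; split=> [|x y|x y]; rewrite /preimage /=.
- by rewrite rmorph0; apply: ideal0.
- by rewrite rmorphD; apply: idealD.
- by rewrite rmorphM; apply: idealM.
Qed.

Lemma preimage_prime K : is_prime K -> is_prime (f @^-1` K).
Proof.
move=> [HK K1 KM]; split; first exact: preimage_ideal.
  by rewrite /preimage /= rmorph1.
by move=> x y; rewrite /preimage /= rmorphM; apply: KM.
Qed.

Hypothesis f_surj : forall y, exists x, f x = y.

Lemma image_surj K : f @` (f @^-1` K) = K.
Proof.
apply/seteqP; split=> [_ [x Kx <-] //|y Ky].
by have [x xy] := f_surj y; exists x => //; rewrite /preimage /= xy.
Qed.

Lemma preimage_surj_inj K K' : f @^-1` K = f @^-1` K' -> K = K'.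
Proof. by move=> E; rewrite -[K]image_surj E image_surj. Qed.

Lemma preimage_addgen K q :
  f @^-1` (addgen K (f q)) = addgen (f @^-1` K) q.
Proof.
apply/seteqP; split=> x [c Hc].
  by have [d Ed] := f_surj c; exists d; rewrite /preimage /= rmorphB rmorphM Ed.
by exists (f c); move: Hc; rewrite /preimage /= rmorphB rmorphM.
Qed.

Lemma relreg_surj K s : relreg (f @^-1` K) s -> relreg K (map f s).
Proof.
elim: s K => [|q s IH] K //= [regq regs]; split; last first.
  by apply: IH; rewrite preimage_addgen.
move=> y; have [x <-] := f_surj y; rewrite -rmorphM => Kx.
exact: (regq x Kx).
Qed.

Lemma preimage_maximal K : is_maximal K -> is_maximal (f @^-1` K).
Proof.
move=> [HK K1 maxK]; split; first exact: preimage_ideal.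
  by rewrite /preimage /= rmorph1.
move=> J HJ J1 KJ.
have kerJ x : f x = 0 -> J x.
  by move=> fx; apply: KJ; rewrite /preimage /= fx; apply: ideal0.
have fJ x : (f @` J) (f x) -> J x.
  move=> [y Jy fyx]; rewrite -[x](subrK y); apply: idealD => //.
  by apply: kerJ; rewrite rmorphB fyx subrr.
have HfJ : is_ideal (f @` J).
  split=> [|_ _ [x Jx <-] [y Jy <-]|a _ [x Jx <-]].
  - by exists 0; [apply: ideal0|rewrite rmorph0].
  - by exists (x + y); [apply: idealD|rewrite rmorphD].
  - by have [b <-] := f_surj a; exists (b * x); [apply: idealM|rewrite rmorphM].
have <- : f @` J = K; last by apply/seteqP; split=> [x Jx|x /fJ //]; exists x.
apply: maxK => //; first by rewrite -(rmorph1 f) => /fJ.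
by move=> y; have [x <-] := f_surj y => Kx; exists x => //; apply: KJ.
Qed.

Lemma noetherian_surj : is_noetherian S -> is_noetherian L.
Proof.
move=> noeS K HK; have [s Es] := noeS _ (preimage_ideal HK).
exists (map f s); apply/seteqP; split; last first.
  apply: ideal_gen_sub => // y /= /mapP[x xs ->].
  suff : (f @^-1` K) x by [].
  by rewrite Es; apply: sub_ideal_gen.
move=> y Ky; have [x Ex] := f_surj y.
suff : (f @^-1` (ideal_gen [set` map f s])) x by rewrite /preimage /= Ex.
have : (f @^-1` K) x by rewrite /preimage /= Ex.
rewrite Es; apply: ideal_gen_sub; first exact/preimage_ideal/ideal_gen_ideal.
by move=> z zs; apply: sub_ideal_gen; rewrite /= map_f.
Qed.

End Transport.

(** * Polynomial extensions and integrality *)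

Section PolyExtension.
Variable B : comNzRingType.
Implicit Types (I : set B) (P : {poly B}).

Definition extI I : set {poly B} := [set P | forall i, I P`_i].

Lemma extI_ideal I : is_ideal I -> is_ideal (extI I).
Proof.
move=> HI; split=> [i|P Q HP HQ i|P Q HQ i].
- by rewrite coef0; apply: ideal0.
- by rewrite coefD; apply: idealD.
- by rewrite coefM; apply: ideal_sum => // j _; apply: idealM.
Qed.

Lemma extI_polyC I c : is_ideal I -> extI I c%:P <-> I c.
Proof.
move=> HI; split=> [/(_ 0%N)|Ic i]; first by rewrite coefC.
by rewrite coefC; case: eqP => // _; apply: ideal0.
Qed.

Lemma extI_regmod I q : regmod I q -> regmod (extI I) q%:P.
Proof. by move=> regq P HP i; apply: regq; rewrite -coefCM. Qed.

Lemma extI0 : extI [set 0] = [set 0].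
Proof.
apply/seteqP; split=> [P HP|_ -> i]; last by rewrite coef0.
by apply/polyP => i; rewrite coef0 HP.
Qed.

Lemma extI_addgen I q :
  is_ideal I -> addgen (extI I) q%:P = extI (addgen I q).
Proof.
move=> HI; apply/seteqP; split=> [P [c Hc] i|P HP].
  by exists c`_i; rewrite -coefMC -coefB.
have [c Hc] := choice HP.
exists (\poly_(i < size P) c i) => i; rewrite coefB coefMC coef_poly.
case: ltnP => [_|leP]; first exact: Hc.
by rewrite nth_default // mul0r subr0; apply: ideal0.
Qed.

Lemma coefM_top (F A : {poly B}) n :
  (size A <= n.+1)%N -> (F * A)`_((size F).-1 + n) = lead_coef F * A`_n.
Proof.
move=> sA; rewrite coefM (bigD1 (inord (size F).-1)) //=.
rewrite inordK ?ltnS ?leq_addr // addKn big1 ?addr0 // => i.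
rewrite -val_eqE /= inordK ?ltnS ?leq_addr // => ne.
case: (ltnP (size F).-1 i) => [lt|le].
  by rewrite [F`_i]nth_default ?mul0r //; exact: leq_trans (leqSpred _) lt.
rewrite [A`_ _]nth_default ?mulr0 //; apply: leq_trans sA _.
by rewrite -addnBAC // -addn1 addnC leq_add2r subn_gt0 ltn_neqAle ne.
Qed.

(** The top coefficient of [F * P] is that of [P] times a unit, so the leading term of [P] is in the
    extended ideal and can be subtracted. *)
Lemma unit_lead_regmod I F :
  is_ideal I -> (exists u, u * lead_coef F = 1) -> regmod (extI I) F.
Proof.
move=> HI [u uF] P; have HE := extI_ideal HI.
have [n] := ubnP (size P); elim: n P => // n IH P; rewrite ltnS => sP HP.
case: n IH sP => [|n] IH sP.
  by move: sP; rewrite leqn0 size_poly_eq0 => /eqP ->; exact: (ideal0 HE).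
have IPn : I P`_n.
  rewrite -[P`_n]mul1r -uF -mulrA -coefM_top //.
  exact: idealM.
have HPn : extI I (P`_n *: 'X^n).
  by move=> i; rewrite coefZ; apply: idealMr.
rewrite -[P](subrK (P`_n *: 'X^n)); apply: (idealD HE) => //.
apply: IH; last by rewrite mulrBr; apply: (idealB HE) => //; apply: (idealM _ HE).
rewrite ltnS; apply/leq_sizeP => i leni.
rewrite coefB coefZ coefXn; case: eqP => [->|/eqP ne]; first by rewrite mulr1 subrr.
rewrite mulr0 subr0 nth_default //; apply: leq_trans sP _.
by rewrite ltn_neqAle eq_sym ne.
Qed.

End PolyExtension.

Lemma determinant_trick (S : comNzRingType) (I : set S) n (A : 'M[S]_n)
    (w : 'I_n -> S) :
  is_ideal I -> (forall i, I (\sum_j A i j * w j)) -> forall j, I (\det A * w j).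
Proof.
move=> HI HA j.
have -> : \det A * w j = \sum_i (\adj A) j i * \sum_k A i k * w k.
  under eq_bigr do rewrite mulr_sumr.
  rewrite exchange_big /= (bigD1 j) //= [X in _ + X]big1 ?addr0.
    have /matrixP/(_ j j) := mul_adj_mx A; rewrite !mxE eqxx mulr1n => <-.
    by rewrite mulr_suml; apply: eq_bigr => i _; rewrite mulrA.
  move=> k nkj; have /matrixP/(_ j k) := mul_adj_mx A.
  rewrite !mxE eq_sym (negbTE nkj) mulr0n => E.
  by under eq_bigr do rewrite mulrA; rewrite -mulr_suml E mul0r.
by apply: ideal_sum => // i _; apply: idealM.
Qed.

Section MonicModulus.
Variables (B : comNzRingType) (F : {poly B}).
Hypothesis F_monic : F \is monic.
Implicit Types (v : {poly B}).

Local Notation r := (size F).-1.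

(** Multiplication by [v] on the free module [B[X]/(F)], in the basis of powers of [X]; row [i]
    holds the coordinates of [v * 'X^i]. *)
Definition mul_mx v : 'M[B]_r := \matrix_(i, j) (Pdiv.Ring.rmodp (v * 'X^i) F)`_j.

Lemma mul_mxE v (i : 'I_r) :
  addgen [set 0] F (v * 'X^i - \sum_j (mul_mx v i j)%:P * 'X^j).
Proof.
rewrite addgen0E; exists (Pdiv.Ring.rdivp (v * 'X^i) F).
rewrite {1}(Pdiv.RingMonic.rdivp_eq F_monic (v * 'X^i)).
set R := Pdiv.Ring.rmodp _ _.
have -> : \sum_j (mul_mx v i j)%:P * 'X^j = R; last by rewrite addrK.
have sR : (size R <= r)%N.
  rewrite -ltnS prednK ?size_poly_gt0 ?monic_neq0 //.
  by rewrite Pdiv.Ring.ltn_rmodp monic_neq0.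
rewrite -[RHS](coefK R) poly_def (big_ord_widen _ (fun j => R`_j *: 'X^j) sR).
rewrite [RHS]big_mkcond /=; apply: eq_bigr => j _; rewrite mxE -/R mul_polyC.
by case: ltnP => // le; rewrite nth_default // scale0r.
Qed.

(** Cayley-Hamilton: the characteristic polynomial of multiplication by [v], evaluated at [v], kills
    the basis modulo [N], hence kills [1]. *)
Lemma integral_mod_monic (N : set {poly B}) v :
  is_ideal N -> N F -> exists2 chi : {poly B}, chi \is monic & N (chi \Po v).
Proof.
move=> HN NF; exists (char_poly (mul_mx v)); first exact: char_poly_monic.
have FN : addgen [set 0] F `<=` N by apply: addgen_min => // _ ->; apply: ideal0.
have -> : char_poly (mul_mx v) \Po v = \det (v%:M - map_mx polyC (mul_mx v)).
  rewrite /char_poly -(det_map_mx (comp_poly v)); congr (\det _).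
  apply/matrixP => i j; rewrite !mxE rmorphB rmorphMn /= comp_polyX comp_polyC.
  by [].
have H : forall j : 'I_r, N (\det (v%:M - map_mx polyC (mul_mx v)) * 'X^j).
  apply: determinant_trick => // i; apply: FN.
  have := mul_mxE v i; congr (addgen _ _ _).
  have E j : (v%:M - map_mx polyC (mul_mx v)) i j = v *+ (i == j) - (mul_mx v i j)%:P.
    by rewrite !mxE.
  under [in RHS]eq_bigr do rewrite E mulrBl.
  rewrite sumrB [in RHS](bigD1 i) //= eqxx mulr1n [X in _ = _ + X - _]big1 ?addr0 // => j nji.
  by rewrite eq_sym (negbTE nji) mulr0n mul0r.
(* For [r = 0] the basis does not contain [1], but then [F] is [1] and [N] is the whole ring. *)
case: (posnP r) H => [r0 _|r_gt0 /(_ (Ordinal r_gt0))]; last by rewrite expr0 mulr1.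
have sF : size F = 1%N by rewrite -[LHS]prednK ?size_poly_gt0 ?monic_neq0 // r0.
have F1 : F = 1.
  by rewrite [F]size1_polyC ?sF //; move/monicP: F_monic; rewrite lead_coefE sF => ->.
by rewrite -[\det _]mulr1; apply: idealM => //; rewrite -F1.
Qed.

End MonicModulus.

Definition unit_lead (B : idomainType) (p : {poly B}) :=
  lead_coef p \is a GRing.unit.

Lemma unit_lead_monic (B : idomainType) (p : {poly B}) :
  unit_lead p -> (lead_coef p)^-1 *: p \is monic.
Proof. by move=> up; rewrite monicE lead_coefZ mulVr. Qed.

Section Contraction.
Variables (B : idomainType) (F : {poly B}).
Hypothesis F_unit : unit_lead F.

Definition contract (N : set {poly B}) : set B := [set c | N c%:P].

Lemma integral_mod (N : set {poly B}) v :
  is_ideal N -> N F -> exists2 chi : {poly B}, chi \is monic & N (chi \Po v).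
Proof.
move=> HN NF; apply: (integral_mod_monic (unit_lead_monic F_unit)) => //.
by rewrite -mul_polyC; apply: idealM.
Qed.

Lemma contract_prime N : is_prime N -> is_prime (contract N).
Proof. exact: (@preimage_prime _ _ (@polyC B)). Qed.

Lemma contract_maximal N : is_maximal N -> N F -> is_maximal (contract N).
Proof.
move=> maxN NF; have [HN N1 Nmax] := maxN.
have HC := @preimage_ideal _ _ (@polyC B) N HN.
split=> //; move=> J HJ J1 NJ; apply/seteqP; split=> // c Jc.
apply: contrapT => nNc.
have [v Hv] : addgen N c%:P 1.
  apply: contrapT => n1; apply: nNc.
  rewrite /contract /= -(Nmax _ (addgen_ideal _ HN) n1 (@sub_addgen _ _ _)).
  exact: addgen_mem.
have [chi chi_mon Nchi] := integral_mod v HN NF.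
(* The element [v] inverts [c] modulo [N]. Its integral equation, multiplied by the power of [c]
   given by the degree, becomes an element [d] of the contraction that is congruent to [1] modulo
   [c]; hence [J] contains [1]. *)
pose d := \sum_(i < size chi) chi`_i * c ^+ ((size chi).-1 - i).
have s_gt0 : (0 < size chi)%N by rewrite size_poly_gt0 monic_neq0.
have Nd : N d%:P.
  have Nx e : N (1 - (v * c%:P) ^+ e).
    by rewrite -[1](expr1n _ e) subrXX; apply: idealMr.
  have -> : d%:P = c%:P ^+ (size chi).-1 * (chi \Po v)
     + \sum_(i < size chi) (chi`_i)%:P * c%:P ^+ ((size chi).-1 - i)
         * (1 - (v * c%:P) ^+ i).
    rewrite comp_polyE mulr_sumr -big_split /= rmorph_sum /=.
    apply: eq_bigr => i _; rewrite rmorphM rmorphXn /= -mul_polyC.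
    have -> : c%:P ^+ (size chi).-1 = c%:P ^+ ((size chi).-1 - i) * c%:P ^+ i.
      by rewrite -exprD subnK // -ltnS prednK.
    by rewrite exprMn; ring.
  apply: idealD => //; first exact: idealM.
  by apply: ideal_sum => // i _; apply: idealM.
apply: J1; have Jd : J d by apply: NJ.
move: Jd; rewrite /d -(prednK s_gt0) big_ord_recr /= subnn expr0 mulr1.
have -> : chi`_(size chi).-1 = 1 by apply/eqP; rewrite -lead_coefE -monicE.
rewrite addrC => Jd; rewrite -[1](addrK (\sum_(i < (size chi).-1)
   chi`_i * c ^+ ((size chi).-1 - i))); apply: idealB => //.
apply: ideal_sum => // i _; apply: idealM => //.
by rewrite -(subnSK (ltn_ord i)) exprSr; apply: idealM.
Qed.

(** The constant term of an integral equation of [v] modulo [P] lies in [Q], hence in [P]. As [P] is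
    prime, either [v] is in [P] or the equation can be divided by [v]; this stops before the
    equation becomes [1 = 0]. *)
Lemma incomparable (P Q : set {poly B}) :
  is_prime P -> is_ideal Q -> P F -> P `<=` Q -> contract P = contract Q -> P = Q.
Proof.
move=> HP HQ PF PQ PQc; apply/seteqP; split=> // v Qv.
have [chi chi_mon Pchi] := integral_mod v (prime_ideal HP) PF.
elim/poly_ind: chi chi_mon Pchi => [|chi c IH].
  by move/monic_neq0; rewrite eqxx.
rewrite comp_polyD comp_polyM comp_polyX comp_polyC => chi_mon Pchi.
have Pc : P c%:P.
  have : contract Q c.
    rewrite /contract /= -[c%:P](addKr ((chi \Po v) * v)).
    by apply: (idealD HQ); [apply: (idealN HQ); apply: idealM|apply: PQ].
  by rewrite -PQc.
have {Pchi} : P ((chi \Po v) * v).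
  by rewrite -[_ * v](addrK c%:P); apply: (idealB (prime_ideal HP)).
have [_ P1 PM] := HP => /PM[Pchi|//]; apply: IH => //.
have [chi0|nz] := eqVneq chi 0.
  case: P1; move: Pc chi_mon; rewrite chi0 mul0r add0r monicE lead_coefC.
  by move=> + /eqP c1; rewrite c1.
move: chi_mon; rewrite !monicE lead_coefDl ?lead_coefMX //.
by rewrite size_mulX // (leq_ltn_trans (size_polyC_leq1 _)) // ltnS size_poly_gt0.
Qed.

End Contraction.

(** * Hilbert's basis theorem and Noether normalization *)

(* The witness is the determinant of multiplication by [G] on [B[X]/(F)]. *)
Lemma norm_mod_unit_lead (B : idomainType) (F G : {poly B}) :
  unit_lead F -> regmod (addgen [set 0] F) G ->
  exists rho u v, rho != 0 /\ rho%:P = u * F + v * G.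
Proof.
move=> F_unit regG; pose F' := (lead_coef F)^-1 *: F.
have F'_monic : F' \is monic by apply: unit_lead_monic.
have F'F : addgen [set 0] F' = addgen [set 0] F.
  have H0 := is_ideal0 {poly B}.
  apply/seteqP; split; apply: addgen_min; try exact: addgen_ideal; try exact: sub_addgen.
    by rewrite /F' -mul_polyC; apply: (idealM _ (addgen_ideal _ H0)); exact: addgen_mem.
  have -> : F = (lead_coef F)%:P * F' by rewrite mul_polyC scalerA divrr // scale1r.
  by apply: (idealM _ (addgen_ideal _ H0)); exact: addgen_mem.
pose A := mul_mx F' G; exists (\det A).
have detA : \det A != 0.
  (* A vector of the left kernel is a nonzero polynomial [al], of degree below that of [F'], with
     [G * al] divisible by [F']. Regularity of [G] would make [F'] divide [al]. *)
  apply/det0P => -[v nzv vA0]; pose al := \sum_i (v 0 i)%:P * 'X^i.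
  have al_poly : al = \poly_(i < (size F').-1) (if insub i is Some j then v 0 j else 0).
    rewrite poly_def; apply: eq_bigr => i _; rewrite mul_polyC.
    by case: insubP => [j _ /val_inj -> //|]; rewrite ltn_ord.
  have : addgen [set 0] F' (G * al).
    have -> : G * al = \sum_i (v 0 i)%:P * (G * 'X^i - \sum_j (A i j)%:P * 'X^j).
      under eq_bigr do rewrite mulrBr.
      rewrite sumrB [X in _ - X](_ : _ = 0) ?subr0.
        by rewrite mulr_sumr; apply: eq_bigr => i _; rewrite mulrCA.
      under eq_bigr do rewrite mulr_sumr; rewrite exchange_big big1 //= => j _.
      under eq_bigr do rewrite mulrA -rmorphM; rewrite -mulr_suml -rmorph_sum /=.
      by have /rowP/(_ j) := vA0; rewrite !mxE => ->; rewrite mul0r.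
    apply: ideal_sum; first exact/addgen_ideal/is_ideal0.
    move=> i _; apply: idealM; first exact/addgen_ideal/is_ideal0.
    exact: mul_mxE.
  rewrite F'F => /regG; rewrite -F'F addgen0E => -[c Ec].
  have al0 : al = 0.
    apply/eqP; apply: contraT => nz; have : (size al < size F')%N.
      rewrite al_poly (leq_ltn_trans (size_poly _ _)) // prednK //.
      by rewrite size_poly_gt0 monic_neq0.
    have nzc : c != 0 by apply: contraNneq nz => c0; rewrite Ec c0 mul0r.
    rewrite Ec size_Mmonic //; move: nzc; rewrite -size_poly_gt0.
    by case: (size c) => // d _; rewrite addSn /= ltnNge leq_addl.
  case/negP: nzv; apply/eqP/rowP => i; rewrite mxE.
  have := congr1 (fun p : {poly B} => p`_i) al_poly.
  by rewrite al0 coef0 coef_poly ltn_ord insubT // => lti ->; congr (v 0 _); apply: val_inj.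
have HI : is_ideal (addgens [set 0] [:: F; G]) by apply/addgens_ideal/is_ideal0.
suff : addgens [set 0] [:: F; G] (\det A)%:P.
  move=> /= [v]; rewrite addgen0E => -[u E]; exists u, v; split=> //.
  by rewrite -E subrK.
have H : forall j : 'I_(size F').-1, addgens [set 0] [:: F; G] (\det (map_mx polyC A) * 'X^j).
  apply: determinant_trick => // i.
  have -> : \sum_j (map_mx polyC A) i j * 'X^j = G * 'X^i
     - (G * 'X^i - \sum_j (A i j)%:P * 'X^j).
    by rewrite subKr; apply: eq_bigr => j _; rewrite mxE.
  apply: idealB => //; first by apply: idealMr => //; apply/addgen_mem/addgen_ideal/is_ideal0.
  by apply: sub_addgen; rewrite -F'F; apply: mul_mxE.
case: (posnP (size F').-1) => [r0|r_gt0]; last first.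
  by have := H (Ordinal r_gt0); rewrite expr0 mulr1 det_map_mx.
have F'1 : F' = 1.
  have sF : size F' = 1%N by rewrite -[LHS]prednK ?size_poly_gt0 ?monic_neq0 // r0.
  by rewrite [F']size1_polyC ?sF //; move/monicP: F'_monic; rewrite lead_coefE sF => ->.
rewrite -[_%:P]mulr1; apply: idealM => //; apply: sub_addgen.
by rewrite -F'F F'1; apply/addgen_mem/is_ideal0.
Qed.

Section HilbertBasis.
Variable B : comNzRingType.
Hypothesis noeB : is_noetherian B.

Lemma hilbert_basis : is_noetherian {poly B}.
Proof.
move=> a Ha.
(* These ideals of leading coefficients grow with [n] and stabilise at some [N], their union being
   finitely generated. The generators of [a] are lifts of generators of [L 0] up to [L N]. *)
pose L n := [set c | exists2 p : {poly B}, a p & (size p <= n.+1)%N /\ p`_n = c].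
have L_ideal n : is_ideal (L n).
  split=> [|_ _ [p ap [sp <-]] [q aq [sq <-]]|c _ [p ap [sp <-]]].
  - by exists 0; [apply: ideal0|rewrite size_poly0 coef0].
  - exists (p + q); first exact: idealD.
    by rewrite coefD (leq_trans (size_polyD _ _)) // geq_max sp.
  - exists (c *: p); first by rewrite -mul_polyC; apply: idealM.
    by rewrite coefZ (leq_trans (size_scale_leq _ _)).
have L_mono n d : L n `<=` L (d + n)%N.
  move=> c [p ap [sp <-]]; exists (p * 'X^d); first exact: idealMr.
  rewrite coefMXn ltnNge leq_addr addKn; split=> //.
  apply: leq_trans (size_polyMleq _ _) _.
  by rewrite size_polyXn addnS /= -addnS addnC leq_add2l.
have lift n : exists Ps : seq {poly B}, [set` Ps] `<=` a /\
    forall c, L n c -> exists q, [/\ addgens [set 0] Ps q, (size q <= n.+1)%N & q`_n = c].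
  have [s Es] := noeB (L_ideal n); rewrite Es ideal_genE.
  have : [set` s] `<=` L n by rewrite Es; apply: sub_ideal_gen.
  elim/last_ind: s {Es} => [|s x IH] sL.
    exists [::]; split=> // _ ->; exists 0; split=> //; first by rewrite size_poly0.
    by rewrite coef0.
  have [|Ps [Psa HPs]] := IH.
    by move=> y ys; apply: sL; rewrite /= mem_rcons in_cons ys orbT.
  have [|p ap [sp pn]] := sL x; first by rewrite /= mem_rcons mem_head.
  exists (rcons Ps p); split=> [y /=|c].
    by rewrite mem_rcons in_cons => /orP[/eqP -> //|]; apply: Psa.
  rewrite !addgens_rcons => -[d /HPs[q [Pq sq qn]]].
  exists (q + d *: p); split.
  - by exists d%:P; rewrite mul_polyC addrK.
  - by rewrite (leq_trans (size_polyD _ _)) // geq_max sq (leq_trans (size_scale_leq _ _)).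
  - by rewrite coefD coefZ qn pn subrK.
have [Ps HPs] := choice lift.
have Lim_ideal : is_ideal (\bigcup_n L n).
  split=> [|x y [n _ Lx] [d _ Ly]|x y [n _ Ly]].
  - by exists 0%N => //; apply: ideal0.
  - exists (d + n)%N => //; apply: (idealD (L_ideal _)); first exact: L_mono.
    by rewrite addnC; apply: L_mono.
  - by exists n => //; apply: (idealM _ (L_ideal _)).
have [s Es] := noeB Lim_ideal.
have [N HN] : exists N, [set` s] `<=` L N.
  have : [set` s] `<=` \bigcup_n L n by rewrite Es; apply: sub_ideal_gen.
  elim: s {Es} => [|x s IH] sL; first by exists 0%N.
  have [|N HN] := IH; first by move=> y ys; apply: sL; rewrite /= in_cons ys orbT.
  have [|n _ Lx] := sL x; first by rewrite /= mem_head.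
  exists (N + n)%N => y /=; rewrite in_cons => /orP[/eqP ->|/HN Ly]; first exact: L_mono.
  by rewrite addnC; apply: L_mono.
have LN n : L n `<=` L (minn n N).
  have [_|_] := leqP n N; first exact: subset_refl.
  move=> c Lc.
  have : (\bigcup_n L n) c by exists n.
  by rewrite Es; apply: ideal_gen_sub.
pose G := flatten [seq Ps i | i <- iota 0 N.+1].
have Ga : [set` G] `<=` a.
  by move=> p /= /flatten_mapP[i _]; apply: (HPs i).1.
exists G; apply/seteqP; split; last exact: ideal_gen_sub.
move=> p; have [n] := ubnP (size p); elim: n p => // n IH p; rewrite ltnS => sp ap.
have HG := ideal_gen_ideal [set` G].
case: n IH sp => [|n] IH sp.
  by move: sp; rewrite leqn0 size_poly_eq0 => /eqP ->; apply: (ideal0 HG).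
have [|q [Pq sq Eq]] := (HPs (minn n N)).2 (p`_n); first by apply: LN; exists p.
have Gq : ideal_gen [set` G] q.
  move: Pq; rewrite -ideal_genE; apply: ideal_gen_sub => // x xP.
  apply: sub_ideal_gen; apply/flatten_mapP; exists (minn n N) => //.
  by rewrite mem_iota ltnS geq_minr.
have aq : a q by move: Gq; apply: ideal_gen_sub.
rewrite -[p](subrK (q * 'X^(n - minn n N))); apply: (idealD HG); last exact: (idealMr _ HG).
apply: IH; last by apply: idealB => //; apply: idealMr.
have le := geq_minl n N.
rewrite ltnS; apply/leq_sizeP => i; rewrite leq_eqVlt coefB coefMXn => /orP[/eqP <-|lt].
  by rewrite ltnNge leq_subr subKn // Eq subrr.
rewrite nth_default ?(leq_trans sp) // ltnNge (leq_trans (leq_subr _ _) (ltnW lt)) /=.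
rewrite nth_default ?subrr // (leq_trans sq) // ltn_subRL.
by rewrite subnK.
Qed.

End HilbertBasis.

(** Noether normalization for one equation: up to an automorphism of the polynomial ring, the
    quotient by [p] is finite over [B]. *)
Definition normalizable (B : idomainType) : Prop :=
  forall p : {poly B}, p != 0 ->
  exists sg ta : {rmorphism {poly B} -> {poly B}},
    [/\ cancel sg ta, cancel ta sg & unit_lead (sg p)].

Section Nagata.
Variable A : idomainType.
Implicit Types p : {poly {poly A}}.

(** With [T] the inner variable, [X + T^N] is substituted for the outer variable [X]; the swap makes
    [T] the main variable, in which [(X + T^N)^i] is monic of degree [N * i]. *)
Definition nagata N : {rmorphism {poly {poly A}} -> {poly {poly A}}} :=
  swapXY \o comp_poly ('X + ('X^N)%:P).

Definition nagata_inv N : {rmorphism {poly {poly A}} -> {poly {poly A}}} :=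
  comp_poly ('X - ('X^N)%:P) \o swapXY.

Lemma nagataK N : cancel (nagata N) (nagata_inv N).
Proof.
move=> p; rewrite /nagata /nagata_inv /= swapXYK -comp_polyA.
by rewrite rmorphD /= comp_polyX comp_polyC subrK comp_polyXr.
Qed.

Lemma nagata_invK N : cancel (nagata_inv N) (nagata N).
Proof.
move=> p; rewrite /nagata /nagata_inv /= -comp_polyA.
by rewrite rmorphB /= comp_polyX comp_polyC addrK comp_polyXr swapXYK.
Qed.

(* For N above the degrees of all coefficients, the top coefficient dominates. *)
Lemma nagata_unit_lead p :
  unit_lead (lead_coef p) -> exists N, unit_lead (nagata N p).
Proof.
move=> up; pose N := (\max_(i < size p) size (p`_i)%R).+1; exists N.
have ltN i : (size (p`_i)%R < N)%N.
  rewrite ltnS; have [lt|le] := ltnP i (size p); last by rewrite nth_default ?size_poly0.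
  exact: (@leq_bigmax _ (fun i : 'I_(size p) => size (p`_i)%R) (Ordinal lt)).
pose M : {poly {poly A}} := 'X^N + 'X%:P.
have sM : size M = N.+1.
  by rewrite /M size_polyDl size_polyXn // (leq_ltn_trans (size_polyC_leq1 _)).
have Mm : M \is monic.
  by rewrite monicE lead_coefDl ?lead_coefXn // size_polyXn (leq_ltn_trans (size_polyC_leq1 _)).
have E : nagata N p = \sum_(i < size p) map_poly polyC (p`_i)%R * M ^+ i.
  rewrite /nagata /= comp_polyE rmorph_sum /=; apply: eq_bigr => i _.
  rewrite -mul_polyC rmorphM rmorphXn /= swapXY_polyC rmorphD /= swapXY_X swapXY_polyC.
  by rewrite rmorphXn /= map_polyX addrC.
have sMi i : size (M ^+ i) = (N * i).+1.
  rewrite -[LHS]prednK ?size_exp ?sM //.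
  by rewrite size_poly_gt0 monic_neq0 // monic_exp.
have sT (q : {poly A}) i : q != 0 -> size (map_poly polyC q * M ^+ i) = (size q + N * i)%N.
  move=> nz; rewrite size_Mmonic ?monic_exp ?sMi ?addnS ?size_map_polyC //.
  by rewrite map_polyC_eq0.
have sT' i : (size (map_poly polyC (p`_i)%R * M ^+ i)%R <= N * i.+1)%N.
  have [->|nz] := eqVneq (p`_i)%R 0; first by rewrite rmorph0 mul0r size_poly0.
  by rewrite sT // mulnS leq_add2r ltnW.
have nzl : lead_coef p != 0.
  by apply: contraTneq up => ->; rewrite /unit_lead lead_coef0 unitr0.
have sp : (0 < size p)%N by rewrite size_poly_gt0 -lead_coef_eq0.
rewrite /unit_lead E -(prednK sp) big_ord_recr /= addrC lead_coefDl.
  rewrite lead_coef_Mmonic ?monic_exp // lead_coef_map_inj ?rmorph0 //; last exact: polyC_inj.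
  exact: rmorph_unit.
rewrite -lead_coefE sT //; apply: leq_ltn_trans (size_sum _ _ _) _.
apply: (@leq_ltn_trans (N * (size p).-1)%N); last by rewrite -[X in (X < _)%N]add0n ltn_add2r size_poly_gt0.
apply/bigmax_leqP => i _; apply: leq_trans (sT' i) _.
by rewrite leq_mul2l ltn_ord orbT.
Qed.

(** An automorphism of the coefficient ring [{poly A}] first gives the leading coefficient of [p] a
    unit leading coefficient; Nagata's substitution then passes this on to the whole polynomial. *)
Lemma normalizable_poly : normalizable A -> normalizable {poly A}.
Proof.
move=> norA p nzp.
have [|sg [ta [sgK taK up]]] := norA (lead_coef p); first by rewrite lead_coef_eq0.
have [|N uN] := @nagata_unit_lead (map_poly sg p).
  by rewrite lead_coef_map_inj ?rmorph0 //; apply: can_inj sgK.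
exists (nagata N \o map_poly sg), (map_poly ta \o nagata_inv N); split=> // q.
  change (map_poly ta (nagata_inv N (nagata N (map_poly sg q))) = q).
  by rewrite nagataK -map_poly_comp; apply: map_poly_id => c _ /=; rewrite sgK.
change (nagata N (map_poly sg (map_poly ta (nagata_inv N q))) = q).
rewrite -map_poly_comp; rewrite (_ : map_poly _ _ = nagata_inv N q) ?nagata_invK //.
by apply: map_poly_id => c _ /=; rewrite taK.
Qed.

End Nagata.

(** * Dimension of polynomial rings and primes of height one *)

Lemma prime_chain_sub (S : comNzRingType) e (C : nat -> set S) i :
  prime_chain e C -> (i <= e)%N -> C 0%N `<=` C i.
Proof.
move=> [_ Cs]; elim: i => [_|i IH lt_ie]; first exact: subset_refl.
by apply: subset_trans (IH (ltnW lt_ie)) _; case: (Cs i lt_ie).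
Qed.

Lemma preimage_chain (S L : comNzRingType) (f : {rmorphism S -> L}) e C :
  (forall K K', is_prime K -> is_prime K' -> f @^-1` K = f @^-1` K' -> K = K') ->
  prime_chain e C -> prime_chain e (fun i => f @^-1` (C i)).
Proof.
move=> inj [Cp Cs]; split=> i le; first exact/preimage_prime/Cp.
have [sub nsub] := Cs i le; split; first by move=> x; apply: sub.
move=> sub'; apply: nsub; rewrite (inj (C i) (C i.+1)) //.
- by apply: Cp; apply: ltnW.
- exact: Cp.
- by apply/seteqP; split=> // x; apply: sub.
Qed.

Lemma contract_chain (B : idomainType) (F : {poly B}) e C :
  unit_lead F -> prime_chain e C -> C 0%N F ->
  prime_chain e (fun i => contract (C i)).
Proof.
move=> uF CC C0F; have [Cp Cs] := CC; split=> i le; first exact/contract_prime/Cp.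
have [sub nsub] := Cs i le; split; first by move=> x; apply: sub.
move=> sub'; apply: nsub; rewrite (@incomparable _ _ uF (C i) (C i.+1)) //.
- by apply: Cp; apply: ltnW.
- exact/prime_ideal/Cp.
- exact: (prime_chain_sub CC (ltnW le) C0F).
- by apply/seteqP; split=> // x; apply: sub.
Qed.

(** What is needed of a polynomial ring in [n] variables over a field, in a form that survives
    adjoining a variable. The bound on chains and the regular sequences together make the local
    rings at maximal ideals Cohen-Macaulay of dimension [n]. *)
Definition good (n : nat) (B : idomainType) : Prop :=
  [/\ is_noetherian B,
      forall e (C : nat -> set B), prime_chain e C -> (e <= n)%N,
      forall N : set B, is_maximal N ->
        exists s, [/\ size s = n, relreg [set 0] s & [set` s] `<=` N] &
      normalizable B].

Lemma good_field (k : fieldType) : good 0 k.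
Proof.
have H0 (I : set k) : is_ideal I -> ~ I 1 -> I = [set 0].
  move=> HI I1; apply/seteqP; split=> [x Ix|_ ->]; last exact: ideal0.
  apply: contrapT => /= /eqP nz; apply: I1; rewrite -(mulVf nz).
  exact: idealM.
split=> [I HI|e C [Cp Cs]|N HN|p nzp].
- have [I1|/(H0 I HI) ->] := pselect (I 1).
    exists [:: 1]; apply/seteqP; split=> x _; last by rewrite -[x]mulr1; apply: idealM.
    rewrite -[x]mulr1; apply: (idealM _ (ideal_gen_ideal _)); apply: sub_ideal_gen.
    by rewrite /= mem_head.
  by exists [::]; rewrite ideal_genE.
- case: e Cp Cs => // e Cp Cs; have [_ []] := Cs 0%N isT.
  have E i : (i <= e.+1)%N -> C i = [set 0] by move=> /Cp[HC C1 _]; apply: H0.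
  by rewrite !E.
- by exists [::].
exists idfun, idfun; split=> //.
by rewrite /unit_lead /= unitfE lead_coef_eq0.
Qed.

Lemma relreg_extI (B : comNzRingType) (I : set B) s :
  is_ideal I -> relreg I s ->
  relreg (extI I) (map polyC s) /\ addgens (extI I) (map polyC s) = extI (addgens I s).
Proof.
elim: s I => [|q s IH] I HI //= [regq regs].
rewrite extI_addgen //; have [H1 H2] := IH _ (addgen_ideal q HI) regs.
by split=> //; split=> //; apply: extI_regmod.
Qed.

Lemma good_poly n (B : idomainType) : good n B -> good n.+1 {poly B}.
Proof.
move=> [noeB dimB regB norB]; split.
- exact: hilbert_basis.
- move=> [//|e] C CC; have [Cp Cs] := CC; rewrite ltnS.
  (* The prime [C 1] is nonzero. Once a nonzero member of it has unit leading coefficient, the chain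
     starting at [C 1] stays strict under contraction to [B]. *)
  have [p C1p /eqP nzp] : exists2 p, C 1%N p & p <> 0.
    apply: contrapT => H; have [_ []] := Cs 0%N isT; move=> p C1p.
    have -> : p = 0 by apply: contrapT => nz; apply: H; exists p.
    exact: (ideal0 (prime_ideal (Cp 0%N isT))).
  have [sg [ta [sgK taK up]]] := norB p nzp.
  pose D i := ta @^-1` (C i.+1).
  have DD : prime_chain e D.
    apply: (@preimage_chain _ _ ta e (fun i => C i.+1)).
      move=> K K' _ _; apply: preimage_surj_inj => q; exists (sg q); exact: sgK.
    by split=> i le; [apply: Cp|apply: Cs].
  apply: (dimB e (fun i => contract (D i))); apply: contract_chain DD _; first exact: up.
  by rewrite /D /preimage /= sgK.
- move=> N maxN; have [HN N1 Nmax] := maxN.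
  (* A maximal ideal is nonzero, as the zero ideal is strictly below the proper ideal of ['X]. *)
  have [p Np /eqP nzp] : exists2 p, N p & p <> 0.
    apply: contrapT => H; have N0 x : N x -> x = 0.
      by move=> Nx; apply: contrapT => nz; apply: H; exists x.
    have HX := addgen_ideal 'X (is_ideal0 {poly B}).
    have := Nmax (addgen [set 0] 'X) HX; rewrite addgen0E => EX.
    have : [set a | exists c : {poly B}, a = c * 'X] = N.
      apply: EX; last by move=> x /N0 ->; exists 0; rewrite mul0r.
      move=> [c /(congr1 (fun p : {poly B} => p`_0))].
      by rewrite coef1 coefMX => /eqP; rewrite oner_eq0.
    move=> E; have /N0/eqP : N 'X by rewrite -E; exists 1; rewrite mul1r.
    by rewrite polyX_eq0.
  have [sg [ta [sgK taK up]]] := norB p nzp.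
  have ta_surj q : exists r, ta r = q by exists (sg q); exact: sgK.
  have maxN' := preimage_maximal ta_surj maxN.
  have N'p : (ta @^-1` N) (sg p) by rewrite /preimage /= sgK.
  have [s [ss regs sN]] := regB _ (contract_maximal up maxN' N'p).
  (* A regular sequence of [B] inside the contraction stays regular after extension, and the
     polynomial with unit leading coefficient is regular modulo the extended ideal. *)
  exists (map ta (rcons (map polyC s) (sg p))); split.
  + by rewrite size_map size_rcons size_map ss.
  + apply: relreg_surj => //; have -> : ta @^-1` [set 0] = [set 0].
      apply/seteqP; split=> x; rewrite /preimage /=; last by move=> ->; rewrite rmorph0.
      by move=> tx; rewrite -(taK x) tx rmorph0.
    rewrite -extI0 relreg_rcons; have [H1 H2] := relreg_extI (is_ideal0 B) regs.
    split=> //; rewrite H2; apply: unit_lead_regmod; first exact/addgens_ideal/is_ideal0.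
    by exists (lead_coef (sg p))^-1; rewrite mulVr.
  + move=> x /= /mapP[y]; rewrite mem_rcons in_cons => /orP[/eqP ->|/mapP[z zs ->]] ->.
      by rewrite sgK.
    exact: (sN z zs).
- exact: normalizable_poly.
Qed.

Section HeightOne.

(** The ideal of elements multiplying [c] into the ideal of [b] contains no regular element modulo
    [b]; it is enlarged to a prime with the same property. *)
Lemma zero_divisor_prime (D : comNzRingType) (a b c : D) :
  addgen [set 0] b (a * c) -> ~ addgen [set 0] b c ->
  exists P, [/\ is_prime P, P a, P b &
    forall s, P s -> ~ regmod (addgen [set 0] b) s].
Proof.
move=> Iac nIc; set I := addgen _ _ in Iac nIc *.
have HI : is_ideal I by apply/addgen_ideal/is_ideal0.
have [||x y Wx Wy z|s Ics Ws|P [HP IP PW]] :=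
  @krull_prime D [set s | I (s * c)] [set s | regmod I s].
- split=> [|x y|x y]; rewrite /= ?mul0r; first exact: ideal0.
    by rewrite mulrDl; apply: idealD.
  by rewrite -mulrA; apply: idealM.
- by move=> x; rewrite mul1r.
- by rewrite -mulrA => /Wx /Wy.
- by apply: nIc; apply: Ws.
exists P; split=> //; first exact: IP.
by apply: IP; apply: idealMr => //; apply/addgen_mem/is_ideal0.
Qed.

Lemma min_size_poly (B : nzRingType) (Q : set {poly B}) p :
  Q p -> exists2 q, Q q & forall r, Q r -> (size q <= size r)%N.
Proof.
have [n] := ubnP (size p); elim: n p => // n IH p lt Qp.
have [[q Qq lt_qp]|H] := pselect (exists2 q, Q q & (size q < size p)%N).
  by apply: (IH q) => //; apply: leq_trans lt_qp _.
exists p => // r Qr; rewrite leqNgt; apply/negP => ltr; apply: H.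
by exists r.
Qed.

(* A prime contracting to zero is generated, up to scalars, by an element of
   least degree. *)
Lemma contract0_minimal (B : idomainType) (P Q : set {poly B}) :
  is_prime P -> is_prime Q -> P `<=` Q -> contract Q = [set 0] ->
  (exists2 p, P p & p != 0) -> P = Q.
Proof.
move=> HP HQ PQ Q0 [p Pp nzp].
have notQ (c : B) : c != 0 -> ~ Q c%:P.
  by move=> /eqP nzc Qc; apply: nzc; have : contract Q c by []; rewrite Q0.
have [w [Pw nzw] minw] := @min_size_poly B [set p | P p /\ p != 0] p (conj Pp nzp).
have [v [Qv nzv] minv] :=
  @min_size_poly B [set p | Q p /\ p != 0] p (conj (PQ p Pp) nzp).
have HQi := prime_ideal HQ; have HPi := prime_ideal HP.
have divQ u : Q u -> exists (c : B) (q : {poly B}), c != 0 /\ c%:P * u = q * v.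
  move=> Qu; exists (lead_coef v ^+ Pdiv.Idomain.scalp u v), (Pdiv.Idomain.divp u v).
  split; first by rewrite expf_neq0 // lead_coef_eq0.
  rewrite mul_polyC Pdiv.Idomain.divp_eq; set r := Pdiv.Idomain.modp u v.
  suff -> : r = 0 by rewrite addr0.
  apply/eqP; apply: contraT => nzr.
  have Qr : Q r.
    have -> : r = lead_coef v ^+ Pdiv.Idomain.scalp u v *: u - Pdiv.Idomain.divp u v * v.
      by rewrite Pdiv.Idomain.divp_eq addrC addKr.
    by apply: idealB => //; rewrite -?mul_polyC; apply: idealM.
  have := minv r (conj Qr nzr); rewrite leqNgt Pdiv.Idomain.ltn_modp nzv.
  by [].
(* In [c * w = q * v] the factor [v] is not constant, since [Q] contracts to zero. Were [v] outside
   [P], the cofactor [q] would be in [P] with degree below that of [w], which is least. *)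
have Pv : P v.
  have [c [q [nzc E]]] := divQ w (PQ w Pw).
  have : P (q * v) by rewrite -E; apply: idealM.
  have [_ _ PM] := HP => /PM[Pq|//].
  have nzq : q != 0.
    apply/eqP => q0; have /eqP : c%:P * w = 0 by rewrite E q0 mul0r.
    by rewrite mulf_eq0 polyC_eq0 (negbTE nzc) (negbTE nzw).
  have := minw q (conj Pq nzq).
  have : size (c%:P * w) = size w by rewrite mul_polyC size_scale.
  rewrite E size_mul // => <-.
  have : (1 < size v)%N.
    rewrite ltnNge; apply/negP => /size1_polyC Ev; apply: (notQ (v`_0)); last by rewrite -Ev.
    by apply: contraNneq nzv => v0; rewrite Ev v0.
  by case: (size v) => [|[|d]] // _; rewrite !addnS /= ltnNge leq_addr.
apply/seteqP; split=> // u Qu; have [c [q [nzc E]]] := divQ u Qu.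
have : P (c%:P * u) by rewrite E; apply: idealM.
by have [_ _ PM] := HP => /PM[/PQ /(notQ _ nzc)|].
Qed.

(** A nonzero constant [c] is regular modulo [F], by exchange: [F] is regular modulo [c] because its
    leading coefficient is a unit. So [P] contains no such constant. *)
Lemma zero_divisor_contract (B : idomainType) (F : {poly B}) (P : set {poly B}) :
  unit_lead F -> is_ideal P ->
  (forall s, P s -> ~ regmod (addgen [set 0] F) s) -> contract P = [set 0].
Proof.
move=> uF HP PW; apply/seteqP; split=> [c Pc|_ ->]; last first.
  by rewrite /contract /= polyC0; apply: ideal0.
apply: contrapT => /= /eqP nzc; apply: (PW _ Pc) => A.
rewrite addgen0E => -[u E].
have : addgen [set 0] c%:P u.
  rewrite -extI0 extI_addgen; last exact: is_ideal0.
  apply: (@unit_lead_regmod _ _ F); first exact/addgen_ideal/is_ideal0.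
    by exists (lead_coef F)^-1; rewrite mulVr.
  rewrite -extI_addgen ?extI0; last exact: is_ideal0.
  by rewrite addgen0E; exists A; rewrite mulrC -E mulrC.
rewrite addgen0E => -[v Ev]; exists v; apply: (@mulfI _ c%:P); first by rewrite polyC_eq0.
by rewrite E Ev; ring.
Qed.

(* A form of Krull's principal ideal theorem. *)
Lemma height_one_prime (B D : idomainType) (phi : {rmorphism {poly B} -> D})
    (psi : {rmorphism D -> {poly B}}) (a b c : D) :
  normalizable B -> cancel phi psi -> cancel psi phi -> b != 0 ->
  addgen [set 0] b (a * c) -> ~ addgen [set 0] b c ->
  exists P, [/\ is_prime P, P a, P b & prime_has_height P 1].
Proof.
move=> norB phiK psiK nzb Iac nIc.
have [P [HP Pa Pb PW]] := zero_divisor_prime Iac nIc.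
exists P; split=> //.
have [|sg [ta [sgK taK up]]] := norB (psi b).
  by apply: contra_neq nzb => E; rewrite -(psiK b) E rmorph0.
pose f : {rmorphism {poly B} -> D} := phi \o ta.
have f_surj y : exists x, f x = y by exists (sg (psi y)); rewrite /f /= sgK psiK.
pose F := sg (psi b); have fF : f F = b by rewrite /f /F /= sgK psiK.
have f_inj x : f x = 0 -> x = 0.
  by rewrite /f /= => /(congr1 (sg \o psi)) /=; rewrite phiK taK !rmorph0.
have f0 : f @^-1` [set 0] = [set 0].
  apply/seteqP; split=> x; first exact: f_inj.
  by move=> ->; rewrite /preimage /= !rmorph0.
split.
  exists (fun i => if i is 0%N then [set 0] else P); split=> //; split.
    case=> [_|i _] //; split; first exact: is_ideal0.
      by move=> /= /eqP; rewrite oner_eq0.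
    by move=> x y /= /eqP; rewrite mulf_eq0 => /orP[] /eqP ->; [left|right].
  case=> // _; split=> [_ ->|]; first exact: (ideal0 (prime_ideal HP)).
  by move=> /(_ _ Pb) /= b0; rewrite b0 eqxx in nzb.
case=> [|[|e]] // C CC CP; have [Cp Cs] := CC.
(* In a chain of length at least two the prime just below [P] is nonzero, while [P], consisting of
   zero divisors modulo [F], contracts to zero. The two therefore coincide, against strictness. *)
have E : f @^-1` (C e.+1) = f @^-1` P.
  apply: contract0_minimal.
  - exact/preimage_prime/Cp.
  - exact: preimage_prime.
  - by rewrite -CP => x; apply: (Cs e.+1 (ltnSn _)).1.
  - apply: (@zero_divisor_contract _ F); first exact: up.
    exact/preimage_ideal/prime_ideal.
    move=> s /PW nreg reg; apply: nreg => y; have [x <-] := f_surj y.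
    rewrite -rmorphM -fF => H; suff : (f @^-1` addgen [set 0] (f F)) x by [].
    rewrite (preimage_addgen f_surj) f0; apply: reg.
    by rewrite -{1}f0 -(preimage_addgen f_surj).
  - have [sub nsub] := Cs e (ltnW (ltnSn _)).
    apply: contrapT => H; apply: nsub => y; have [x <-] := f_surj y => Cx.
    have -> : x = 0 by apply: contrapT => /eqP nz; apply: H; exists x.
    by rewrite rmorph0; apply: (ideal0 (prime_ideal (Cp e _))); rewrite ltnW.
have [_] := Cs e.+1 (ltnSn _); rewrite CP => H; case: H.
by rewrite -(preimage_surj_inj f_surj E).
Qed.

End HeightOne.

(** * Cohen-Macaulay determinantal rings *)

Section Localization.
Variables (S L : comNzRingType) (M : set S) (f : {rmorphism S -> L}).
Hypotheses (M_prime : is_prime M) (f_loc : is_localization_at M f).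

Definition loc_ideal (I : set S) : set L :=
  [set y | exists a s, [/\ ~ M s, I a & y * f s = f a]].

Lemma notM1 : ~ M 1.
Proof. by case: M_prime. Qed.

Lemma notMM a b : ~ M a -> ~ M b -> ~ M (a * b).
Proof. by case: M_prime => _ _ MM na nb /MM[]. Qed.

Lemma loc_eq a b : f a = f b -> exists s, ~ M s /\ s * a = s * b.
Proof.
case: f_loc => _ _ ker E; have [|s [ns Es]] := ker (a - b).
  by rewrite rmorphB E subrr.
by exists s; split=> //; apply: subr0_eq; rewrite -mulrBr.
Qed.

Lemma loc_inv s : ~ M s -> exists u, f s * u = 1.
Proof. by case: f_loc => + _ _; apply. Qed.

Lemma loc_frac y : exists a s, ~ M s /\ y * f s = f a.
Proof. by case: f_loc => _ + _; apply. Qed.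

Lemma loc_ideal_ideal I : is_ideal I -> is_ideal (loc_ideal I).
Proof.
move=> HI; split=> [|x y [a [s [ns Ia Ex]]] [b [t [nt Ib Ey]]]|x y [b [t [nt Ib Ey]]]].
- exists 0, 1; split; [exact: notM1|exact: ideal0|by rewrite mul0r rmorph0].
- exists (a * t + b * s), (s * t); split; first exact: notMM.
    by apply: idealD => //; apply: idealMr.
  by rewrite rmorphD !rmorphM -Ex -Ey; ring.
- have [a [s [ns Ex]]] := loc_frac x.
  exists (a * b), (s * t); split; [exact: notMM|exact: idealM|].
  by rewrite !rmorphM -Ex -Ey; ring.
Qed.

Lemma loc_idealE I a : is_ideal I -> loc_ideal I (f a) <-> exists s, ~ M s /\ I (s * a).
Proof.
move=> HI; split=> [[b [t [nt Ib]]]|[s [ns Isa]]]; last first.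
  by exists (s * a), s; split=> //; rewrite rmorphM mulrC.
rewrite -rmorphM => /loc_eq[s [ns E]]; exists (s * t).
split; first exact: notMM.
by rewrite -mulrA [t * a]mulrC E; apply: idealM.
Qed.

Lemma loc_ideal0 : loc_ideal [set 0] = [set 0].
Proof.
apply/seteqP; split=> [y [a [s [ns -> E]]]|_ ->]; last first.
  by exists 0, 1; split; [exact: notM1| |rewrite mul0r rmorph0].
by have [u su] := loc_inv ns; rewrite /= -[y]mulr1 -su mulrA E rmorph0 mul0r.
Qed.

Lemma loc_ideal_addgen I q :
  is_ideal I -> addgen (loc_ideal I) (f q) = loc_ideal (addgen I q).
Proof.
move=> HI; apply/seteqP; split=> [y [c [a [s [ns Ia E]]]]|y [a [s [ns [c Ic] E]]]].
  have [b [t [nt Et]]] := loc_frac c.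
  exists (a * t + s * b * q), (s * t); split; first exact: notMM.
    exists (s * b); rewrite addrK; exact: idealMr.
  rewrite rmorphD !rmorphM -E -Et; ring.
have [u su] := loc_inv ns; exists (f c * u), (a - c * q), s; split=> //.
by rewrite mulrBl E rmorphB rmorphM -[in RHS](mulr1 (f c)) -su; ring.
Qed.

Lemma loc_relreg I s : is_ideal I -> relreg I s -> relreg (loc_ideal I) (map f s).
Proof.
elim: s I => [|q s IH] I HI //= [regq regs]; split; last first.
  by rewrite loc_ideal_addgen //; apply: IH => //; apply: addgen_ideal.
move=> y [a [s' [ns Ia E]]]; have [b [t [nt Et]]] := loc_frac y.
have [|w [nw Ew]] := @loc_eq (s' * (q * b)) (t * a).
  by rewrite !rmorphM -Et -E; ring.
exists (w * s' * b), (t * (w * s')); split.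
- by apply: notMM => //; apply: notMM.
- apply: regq; have -> : q * (w * s' * b) = w * (s' * (q * b)) by ring.
  by rewrite Ew; apply: idealM => //; apply: idealM.
- by rewrite !rmorphM mulrA Et; ring.
Qed.

Lemma loc_preimage_inj K K' :
  is_prime K -> is_prime K' -> f @^-1` K = f @^-1` K' -> K = K'.
Proof.
suff sub K1 K2 : is_prime K1 -> is_prime K2 -> f @^-1` K1 = f @^-1` K2 -> K1 `<=` K2.
  by move=> HK HK' E; apply/seteqP; split; apply: sub.
move=> /prime_ideal H1 /prime_ideal H2 E y Ky; have [a [s [ns Es]]] := loc_frac y.
have [u su] := loc_inv ns; have : (f @^-1` K1) a by rewrite /preimage /= -Es; apply: idealMr.
by rewrite E /preimage /= -Es => K2y; rewrite -[y]mulr1 -su mulrA; apply: idealMr.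
Qed.

Lemma loc_noetherian : is_noetherian S -> is_noetherian L.
Proof.
move=> noeS K HK; have [s Es] := noeS _ (@preimage_ideal _ _ f K HK).
exists (map f s); apply/seteqP; split; last first.
  apply: ideal_gen_sub => // y /= /mapP[x xs ->].
  suff : (f @^-1` K) x by [].
  by rewrite Es; apply: sub_ideal_gen.
move=> y Ky; have [a [t [nt Et]]] := loc_frac y; have [u tu] := loc_inv nt.
rewrite -[y]mulr1 -tu mulrA Et; apply: (idealMr _ (ideal_gen_ideal _)).
suff : (f @^-1` (ideal_gen [set` map f s])) a by [].
have : (f @^-1` K) a by rewrite /preimage /= -Et; apply: idealMr.
rewrite Es; apply: ideal_gen_sub; first exact/preimage_ideal/ideal_gen_ideal.
by move=> z zs; apply: sub_ideal_gen; rewrite /= map_f.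
Qed.

Lemma loc_ideal1 : ~ loc_ideal M 1.
Proof.
rewrite -(rmorph1 f) loc_idealE; last exact: prime_ideal.
by move=> [s [ns]]; rewrite mulr1.
Qed.

Lemma loc_proper_sub K : is_ideal K -> ~ K 1 -> K `<=` loc_ideal M.
Proof.
move=> HK K1 y Ky; have [a [s [ns E]]] := loc_frac y.
exists a, s; split=> //; apply: contrapT => /loc_inv[u au]; apply: K1.
by rewrite -au -E -mulrA; apply: idealMr.
Qed.

Lemma loc_maximal N : is_maximal N <-> N = loc_ideal M.
Proof.
have HM := loc_ideal_ideal (prime_ideal M_prime).
split=> [[HN N1 maxN]|->]; first by rewrite (maxN _ HM loc_ideal1) //; apply: loc_proper_sub.
split=> // [|J HJ J1 MJ]; first exact: loc_ideal1.
by apply/seteqP; split=> //; apply: loc_proper_sub.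
Qed.

(** The images of [s] give depth at least [n] and a chain of primes of length [n]. Primes pull back
    injectively to [S], so the dimension is at most [n], and the chain attached to any regular
    sequence bounds the depth by it. *)
Lemma loc_cohen_macaulay n s :
  is_noetherian S ->
  (forall e (C : nat -> set S), prime_chain e C -> (e <= n)%N) ->
  size s = n -> relreg [set 0] s -> [set` s] `<=` M ->
  is_local_cohen_macaulay L.
Proof.
move=> noeS dimS ss regs sM; split; first exact: loc_noetherian.
exists (loc_ideal M); split; first exact: loc_maximal.
have HML := loc_ideal_ideal (prime_ideal M_prime).
have ML_prime : is_prime (loc_ideal M) by apply/maximal_prime/loc_maximal.
have dimL e (C : nat -> set L) : prime_chain e C -> (e <= n)%N.
  by move=> /(preimage_chain loc_preimage_inj)/dimS.
have regL : relreg [set 0] (map f s).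
  by rewrite -loc_ideal0; apply: loc_relreg => //; apply: is_ideal0.
have sML : [set` map f s] `<=` loc_ideal M.
  move=> _ /= /mapP[x xs ->]; exists x, 1; rewrite rmorph1 mulr1.
  by split; [exact: notM1|exact: sM|].
have chainL s' : relreg [set 0] s' -> [set` s'] `<=` loc_ideal M ->
    exists C : nat -> set L, prime_chain (size s') C.
  move=> regs' s'M; have [||C [CC _ _]] := relreg_prime_chain _ regs' ML_prime _ s'M.
  - exact: is_ideal0.
  - by move=> _ ->; apply: (ideal0 HML).
  - by exists C.
have sfs : size (map f s) = n by rewrite size_map.
exists n; split; split.
- exists (map f s); split=> //; split; first exact/relregP.
  by move=> /(@ideal_gen_sub _ _ _ HML sML)/loc_ideal1.
- by move=> s' [/relregP regs' _] s'M; have [C /dimL] := chainL s' regs' s'M.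
- by have [C] := chainL _ regL sML; rewrite sfs; exists C.
- exact: dimL.
Qed.

End Localization.

Section HilbertBurchCohenMacaulay.

(** Having unit leading coefficients in successive variables, [rho] and [F] form a regular sequence
    modulo every ideal extended from [B]. This is what the statement on syzygies asks for at each
    stage of [s]. *)
Lemma hb_relreg (B : idomainType) (t c a b X Y : {poly {poly B}}) (F : {poly {poly B}})
    (rho : {poly B}) (I : set B) s :
  let J := hb_ideal t c a b X Y in
  unit_lead F -> unit_lead rho -> J [set 0] F -> J [set 0] rho%:P ->
  is_ideal I -> relreg I s ->
  relreg (J (extI (extI I))) (map (fun q => q%:P%:P) s).
Proof.
move=> J uF urho JF Jrho; elim: s I => [|q s IH] I HI //= [regq regs].
have HE := extI_ideal (extI_ideal HI).
have addE : addgen (extI (extI I)) q%:P%:P = extI (extI (addgen I q)).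
  by rewrite extI_addgen ?extI_addgen //; apply: extI_ideal.
have HIq := addgen_ideal q HI.
split; last by rewrite addgen_hb_ideal // addE; apply: IH.
apply: (hb_regmod HE Jrho JF); first exact: (extI_regmod (extI_regmod regq)).
rewrite addE /=; split; last split=> //.
  apply: (@extI_regmod _ (extI (addgen I q))); apply: unit_lead_regmod => //.
  by exists (lead_coef rho)^-1; rewrite mulVr.
rewrite extI_addgen; last exact: extI_ideal.
apply: unit_lead_regmod; first exact/addgen_ideal/extI_ideal.
by exists (lead_coef F)^-1; rewrite mulVr.
Qed.

Lemma hb_cohen_macaulay_normalized n (B : idomainType) (S : comNzRingType)
    (Pi : {rmorphism {poly {poly B}} -> S}) (t c a b X Y : {poly {poly B}})
    (F : {poly {poly B}}) (rho : {poly B}) :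
  let J := hb_ideal t c a b X Y [set 0] in
  good n B -> (forall y, exists x, Pi x = y) -> (forall z, Pi z = 0 <-> J z) ->
  unit_lead F -> unit_lead rho -> J F -> J rho%:P -> is_cohen_macaulay S.
Proof.
move=> J [noeB dimB regB _] Pi_surj kerPi uF urho JF Jrho.
have noeS : is_noetherian S by apply: (noetherian_surj Pi_surj); do 2!apply: hilbert_basis.
have PiF : Pi F = 0 by apply/kerPi.
have Pirho : Pi rho%:P = 0 by apply/kerPi.
split=> // M maxM L f f_loc.
have M_prime := maximal_prime maxM.
have maxN := preimage_maximal Pi_surj maxM.
have M0 := ideal0 (prime_ideal M_prime).
have maxN1 : is_maximal (contract (Pi @^-1` M)).
  by apply: (contract_maximal uF maxN); rewrite /preimage /= PiF.
have maxN2 : is_maximal (contract (contract (Pi @^-1` M))).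
  by apply: (contract_maximal urho maxN1); rewrite /contract /preimage /= Pirho.
have [s [ss regs sN]] := regB _ maxN2.
apply: (@loc_cohen_macaulay _ _ M f M_prime f_loc n (map Pi (map (fun q => q%:P%:P) s))) => //.
- move=> e C CC.
  have CC1 := preimage_chain (fun K K' _ _ => @preimage_surj_inj _ _ _ Pi_surj K K') CC.
  have C0 : C 0%N 0 by apply: (ideal0 (prime_ideal _)); case: CC => + _; apply.
  have CC2 := contract_chain uF CC1.
  have {}CC2 : prime_chain e (fun i => contract (Pi @^-1` C i)).
    by apply: CC2; rewrite /preimage /= PiF.
  apply: (dimB e _ (contract_chain urho CC2 _)).
  by rewrite /contract /preimage /= Pirho.
- by rewrite !size_map.
- apply: relreg_surj => //; have -> : Pi @^-1` [set 0] = J.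
    by apply/seteqP; split=> z /kerPi.
  rewrite /J -(extI0 {poly B}) -(extI0 B).
  apply: (@hb_relreg _ _ _ _ _ _ _ F rho) => //; exact: is_ideal0.
- by move=> _ /= /mapP[_ /mapP[q qs ->] ->]; apply: (sN q qs).
Qed.

Lemma hb_ideal_iso (S S' : comNzRingType) (sg : {rmorphism S -> S'}) t c a b X Y z :
  hb_ideal t c a b X Y [set 0] z ->
  hb_ideal (sg t) (sg c) (sg a) (sg b) (sg X) (sg Y) [set 0] (sg z).
Proof.
move=> [u [v [w /subr0_eq ->]]]; exists (sg u), (sg v), (sg w).
by apply/eqP; rewrite subr_eq0 -!rmorphM -!rmorphD -rmorphM -rmorphB -!rmorphM -!rmorphD.
Qed.

(** The first automorphism turns [f] into [F] with unit leading coefficient. The norm [rho] of [G]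
    modulo [F] is then a nonzero element of the ideal free of the outer variable; a second
    automorphism, acting on coefficients, normalizes [rho] and keeps the leading coefficient of [F]
    a unit. *)
Lemma hb_cohen_macaulay n (B : idomainType) (S : comNzRingType)
    (Pi : {rmorphism {poly {poly B}} -> S}) (t c a b X Y : {poly {poly B}}) :
  good n B -> (forall y, exists x, Pi x = y) ->
  (forall z, Pi z = 0 <-> hb_ideal t c a b X Y [set 0] z) ->
  t * X + c * Y != 0 ->
  regmod (addgen [set 0] (t * X + c * Y)) (a * X + b * Y) ->
  is_cohen_macaulay S.
Proof.
move=> gB Pi_surj kerPi nzf regg; have [_ _ _ norB] := gB.
have [sg [ta [sgK taK uF]]] := normalizable_poly norB nzf.
set F := sg _ in uF; pose G := sg (a * X + b * Y).
have regG : regmod (addgen [set 0] F) G.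
  move=> x; rewrite addgen0E => -[u E].
  have : addgen [set 0] (t * X + c * Y) (ta x).
    apply: regg; rewrite addgen0E; exists (ta u).
    by rewrite -[a * X + b * Y]sgK -rmorphM E rmorphM sgK.
  by rewrite !addgen0E => -[v Ev]; exists (sg v); rewrite -rmorphM -Ev taK.
have [rho [u [v [nzrho Erho]]]] := norm_mod_unit_lead uF regG.
have [sg' [ta' [sgK' taK' urho]]] := norB _ nzrho.
pose s2 : {rmorphism {poly {poly B}} -> {poly {poly B}}} := map_poly sg' \o sg.
pose t2 : {rmorphism {poly {poly B}} -> {poly {poly B}}} := ta \o map_poly ta'.
have mK : cancel (map_poly sg') (map_poly ta').
  by move=> p; rewrite -map_poly_comp; apply: map_poly_id => q _ /=; rewrite sgK'.
have mK' : cancel (map_poly ta') (map_poly sg').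
  by move=> p; rewrite -map_poly_comp; apply: map_poly_id => q _ /=; rewrite taK'.
have s2K : cancel s2 t2 by move=> p; rewrite /s2 /t2 /= mK sgK.
have t2K : cancel t2 s2 by move=> p; rewrite /s2 /t2 /= taK mK'.
have ker2 z : Pi (t2 z) = 0 <->
    hb_ideal (s2 t) (s2 c) (s2 a) (s2 b) (s2 X) (s2 Y) [set 0] z.
  rewrite kerPi; split=> [/(hb_ideal_iso s2)|/(hb_ideal_iso t2)]; first by rewrite t2K.
  by rewrite !s2K.
apply: (@hb_cohen_macaulay_normalized n B S (Pi \o t2) (s2 t) (s2 c) (s2 a) (s2 b)
  (s2 X) (s2 Y) (map_poly sg' F) (sg' rho)) => //.
- by move=> y; have [x <-] := Pi_surj y; exists (s2 x); congr (Pi _); exact: s2K.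
- rewrite /unit_lead (lead_coef_map_inj (can_inj sgK')) ?rmorph0 //.
  exact: rmorph_unit.
- exists 1, 0, 0; apply/eqP; rewrite subr_eq0 mul1r !mul0r !addr0 /F.
  by rewrite -!rmorphM -!rmorphD.
- exists (map_poly sg' u), (map_poly sg' v), 0.
  apply/eqP; rewrite subr_eq0 mul0r addr0 -map_polyC /= Erho rmorphD !rmorphM /=.
  by rewrite /F /G /= !rmorphD !rmorphM.
Qed.

End HilbertBurchCohenMacaulay.

(** * Evaluation of polynomials *)

Section Evaluation.

Lemma mpoly_ring_ind n (A : comNzRingType) (P : {mpoly A[n]} -> Prop) :
  (forall c, P c%:MP) -> (forall i, P 'X_i) ->
  (forall p q, P p -> P q -> P (p + q)) -> (forall p q, P p -> P q -> P (p * q)) ->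
  forall p, P p.
Proof.
move=> PC PX PD PM p.
have P0 : P 0 by rewrite -(mpolyC0 n A).
have P1 : P 1 by apply: (PC 1).
rewrite [p]mpolyE; elim/big_ind: _ => // mu _.
rewrite -mul_mpolyC; apply: (PM _ _ (PC _)); rewrite mpolyXE_id.
elim/big_ind: _ => // i _; elim: (mu i) => [|d IH] //.
by rewrite exprS; apply: PM.
Qed.

(* Opaque, lest unification unfold the evaluation of large nested polynomials. *)
Fact eval_mpoly_subproof n (A S : comNzRingType) (f : {rmorphism A -> S})
    (u : 'I_n -> S) :
  {e : {rmorphism {mpoly A[n]} -> S} |
    (forall c, e c%:MP = f c) /\ (forall i, e 'X_i = u i)}.
Proof.
exists (mmap f u); split=> [c|i]; first exact: mmapC.
by rewrite /= mmapX mmap1U.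
Qed.

Definition eval_mpoly n (A S : comNzRingType) (f : {rmorphism A -> S})
  (u : 'I_n -> S) : {rmorphism {mpoly A[n]} -> S} := sval (eval_mpoly_subproof f u).

Lemma eval_mpolyC n (A S : comNzRingType) (f : {rmorphism A -> S}) (u : 'I_n -> S) c :
  eval_mpoly f u c%:MP = f c.
Proof. exact: (svalP (eval_mpoly_subproof f u)).1. Qed.

Lemma eval_mpolyX n (A S : comNzRingType) (f : {rmorphism A -> S}) (u : 'I_n -> S) i :
  eval_mpoly f u 'X_i = u i.
Proof. exact: (svalP (eval_mpoly_subproof f u)).2. Qed.

Lemma mpoly_rmorph_ext n (A S : comNzRingType) (f g : {rmorphism {mpoly A[n]} -> S}) :
  (forall c, f c%:MP = g c%:MP) -> (forall i, f 'X_i = g 'X_i) -> f =1 g.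
Proof.
move=> EC EX; apply: mpoly_ring_ind => // p q Ep Eq.
  by rewrite !rmorphD Ep Eq.
by rewrite !rmorphM Ep Eq.
Qed.

Lemma eval_mpoly_mod n (A : comNzRingType) (I : set {mpoly A[n]})
    (e : {rmorphism {mpoly A[n]} -> {mpoly A[n]}}) :
  is_ideal I -> (forall c, I (e c%:MP - c%:MP)) -> (forall i, I (e 'X_i - 'X_i)) ->
  forall p, I (e p - p).
Proof.
move=> HI HC HX; apply: mpoly_ring_ind => // p q Ip Iq.
  have -> : e (p + q) - (p + q) = (e p - p) + (e q - q) by rewrite rmorphD; ring.
  exact: idealD.
have -> : e (p * q) - p * q = (e p - p) * e q + p * (e q - q) by rewrite rmorphM; ring.
by apply: idealD => //; [apply: idealMr|apply: idealM].
Qed.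

Fact eval_poly_subproof (A S : comNzRingType) (f : {rmorphism A -> S}) (u : S) :
  {e : {rmorphism {poly A} -> S} | (forall c, e c%:P = f c) /\ e 'X = u}.
Proof.
exists (horner_morph (fun c => mulrC u (f c))).
by split=> [c|] /=; rewrite ?horner_morphC ?horner_morphX.
Qed.

Definition eval_poly (A S : comNzRingType) (f : {rmorphism A -> S}) (u : S) :
  {rmorphism {poly A} -> S} := sval (eval_poly_subproof f u).

Lemma eval_polyC (A S : comNzRingType) (f : {rmorphism A -> S}) (u : S) c :
  eval_poly f u c%:P = f c.
Proof. exact: (svalP (eval_poly_subproof f u)).1. Qed.

Lemma eval_polyX (A S : comNzRingType) (f : {rmorphism A -> S}) (u : S) :
  eval_poly f u 'X = u.
Proof. exact: (svalP (eval_poly_subproof f u)).2. Qed.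

Lemma poly_rmorph_ext (A S : comNzRingType) (f g : {rmorphism {poly A} -> S}) :
  (forall c, f c%:P = g c%:P) -> f 'X = g 'X -> f =1 g.
Proof.
move=> EC EX; elim/poly_ind => [|p c IH]; first by rewrite !rmorph0.
by rewrite !rmorphD !rmorphM /= IH EX EC.
Qed.

Lemma ord3P (P : 'I_3 -> Prop) : P ord3_0 -> P ord3_1 -> P ord3_2 -> forall i, P i.
Proof.
by move=> H0 H1 H2 [[|[|[|//]]] lt]; [move: H0|move: H1|move: H2];
  congr P; apply: val_inj.
Qed.

Lemma mpoly3_poly_iso (A : comNzRingType) :
  exists (f : {rmorphism {poly {poly {poly A}}} -> {mpoly A[3]}})
    (g : {rmorphism {mpoly A[3]} -> {poly {poly {poly A}}}}), cancel f g /\ cancel g f.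
Proof.
pose f1 := eval_poly (@mpolyC 3 A) 'X_ord3_0.
pose f2 := eval_poly f1 'X_ord3_1; pose f := eval_poly f2 'X_ord3_2.
pose g := eval_mpoly (polyC \o polyC \o polyC : {rmorphism A -> {poly {poly {poly A}}}})
    (fun i : 'I_3 => [:: 'X%:P%:P; 'X%:P; 'X]`_i).
have fC p : f p%:P = f2 p by apply: eval_polyC.
have fX : f 'X = 'X_ord3_2 by apply: eval_polyX.
have f2C p : f2 p%:P = f1 p by apply: eval_polyC.
have f2X : f2 'X = 'X_ord3_1 by apply: eval_polyX.
have f1C c : f1 c%:P = c%:MP by apply: eval_polyC.
have f1X : f1 'X = 'X_ord3_0 by apply: eval_polyX.
have gC c : g c%:MP = c%:P%:P%:P by apply: eval_mpolyC.
have gX i : g 'X_i = [:: 'X%:P%:P; 'X%:P; 'X]`_i by apply: eval_mpolyX.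
clearbody f g f1 f2; exists f, g; split.
  apply: (@poly_rmorph_ext _ _ (g \o f) idfun) => [p|] /=; last by rewrite fX gX.
  apply: (@poly_rmorph_ext _ _ (g \o f \o polyC) polyC) => [q|] /=.
    apply: (@poly_rmorph_ext _ _ (g \o f \o polyC \o polyC) (polyC \o polyC)) => [c|] /=.
      by rewrite fC f2C f1C gC.
    by rewrite fC f2C f1X gX.
  by rewrite fC f2X gX.
apply: (@mpoly_rmorph_ext _ _ _ (f \o g) idfun) => [c|] /=.
  by rewrite gC fC f2C f1C.
by apply: ord3P; rewrite gX /= ?fC ?f2C ?f1X ?f2X ?fX.
Qed.

End Evaluation.

(** * The Rees algebra as a quotient *)

Lemma det_mx22 (A : comNzRingType) (M : 'M[A]_2) :
  \det M = M 0 0 * M 1 1 - M 0 1 * M 1 0.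
Proof.
rewrite (expand_det_row _ 0) !big_ord_recl big_ord0 /cofactor !det_mx11 !mxE /=.
rewrite addr0 expr0 expr1 mul1r mulN1r mulrN.
by do ![congr (_ + _)|congr (- _)|congr (_ * _)|congr (M _ _)]; apply: val_inj.
Qed.

Lemma ord2P (P : 'I_2 -> Prop) : P 0 -> P 1 -> forall i, P i.
Proof.
by move=> H0 H1 [[|[|//]] lt]; [move: H0|move: H1]; congr P; apply: val_inj.
Qed.

Section Setting.
Variables (k : fieldType) (m : nat) (p1 p2 p3 : {mpoly k[3]}).
Local Notation R := {mpoly k[3]}.
Local Notation T := {mpoly R[3]}.
Local Notation x := (var_x k).
Local Notation y := (var_y k).
Local Notation phi := (phi_mx m p1 p2 p3).
Local Notation Delta := (x ^+ m * p2 - y ^+ m * p1).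

Lemma signed_minorE :
  [/\ signed_minor phi ord3_0 = y ^+ m * p3, signed_minor phi ord3_1 = - (x ^+ m * p3)
    & signed_minor phi ord3_2 = Delta].
Proof.
by split; rewrite /signed_minor det_mx22 !mxE /= ?expr0 ?expr1 ?sqrrN; ring.
Qed.

Lemma minor2_signed d : is_minor phi 2 d -> exists c i, d = c * signed_minor phi i.
Proof.
have [E0 E1 E2] := signed_minorE.
move=> [r [c [Hr Hc ->]]].
have c01 : c 0 = 0 /\ c 1 = 1.
  have := Hc 0 1 isT; elim/ord2P: (c 0); elim/ord2P: (c 1) => //.
have -> : \det (mxsub r c phi) = phi (r 0) 0 * phi (r 1) 1 - phi (r 0) 1 * phi (r 1) 0.
  by rewrite det_mx22 !mxE; case: c01 => -> ->.
have := Hr 0 1 isT; elim/ord3P: (r 0); elim/ord3P: (r 1) => // _; rewrite !mxE /=.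
- by exists 1, ord3_2; rewrite E2; ring.
- by exists (-1), ord3_1; rewrite E1; ring.
- by exists 1, ord3_0; rewrite E0; ring.
Qed.

Lemma signed_minor_mem i : minor_ideal phi 2 (signed_minor phi i).
Proof.
apply: (idealM _ (ideal_gen_ideal _)); apply: sub_ideal_gen.
exists (lift i), id; split=> //.
move=> a b; rewrite /= /bump => lt_ab.
case: (leqP i a) => [le|_]; last by rewrite add0n (leq_trans lt_ab) // leq_addl.
by rewrite (leq_trans le (ltnW lt_ab)) !add1n.
Qed.

Lemma minor2_ideal_min (P : set R) :
  is_ideal P -> (forall i, P (signed_minor phi i)) -> minor_ideal phi 2 `<=` P.
Proof.
move=> HP Pi; apply: ideal_gen_sub => // d /minor2_signed[c [i ->]].
exact: idealM.
Qed.

Lemma minor1_mem i j : minor_ideal phi 1 (phi i j).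
Proof.
apply: sub_ideal_gen; exists (fun=> i), (fun=> j); split=> [a b|a b|].
- by case: a b => [[|//] ?] [[|//] ?].
- by case: a b => [[|//] ?] [[|//] ?].
- by rewrite det_mx11 [RHS]mxE.
Qed.

Lemma minor1_ideal_min (P : set R) :
  is_ideal P -> P (x ^+ m) -> P (y ^+ m) -> P p1 -> P p2 -> P p3 ->
  minor_ideal phi 1 `<=` P.
Proof.
move=> HP Px Py P1 P2 P3; apply: ideal_gen_sub => // d [r [c [_ _ ->]]].
rewrite det_mx11 !mxE; case: ifP => _; elim/ord3P: (r 0) => //=.
exact: ideal0.
Qed.

Lemma sym_relationE :
  sym_relation phi ord0 =
    'X_ord3_0 * (x ^+ m)%:MP + 'X_ord3_1 * (y ^+ m)%:MP + 'X_ord3_2 * 0%:MP /\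
  sym_relation phi ord_max =
    'X_ord3_0 * p1%:MP + 'X_ord3_1 * p2%:MP + 'X_ord3_2 * p3%:MP.
Proof.
have E (F : 'I_3 -> T) : \sum_i F i = F ord3_0 + F ord3_1 + F ord3_2.
  rewrite !big_ord_recl big_ord0 addr0 addrA.
  by do ![congr (_ + _)|congr (F _)]; apply: val_inj.
by split; rewrite /sym_relation !mxE E !mxE.
Qed.

Lemma rees_mapC c : rees_map phi c%:MP = c%:P.
Proof. exact: mmapC. Qed.

Lemma rees_mapX i : rees_map phi 'X_i = signed_minor phi i *: 'X.
Proof. by rewrite /rees_map mmapX mmap1U. Qed.

Lemma rees_map_pred F : rees_map phi F \in rees_pred (minor_ideal phi 2).
Proof.
elim/mpoly_ring_ind: F => [c|i|p q|p q].
- rewrite rees_mapC; apply/asboolP => -[|i]; first exact: ideal_pow0.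
  by rewrite coefC /=; exact: (ideal0 (ideal_gen_ideal _)).
- rewrite rees_mapX; apply/asboolP => -[|[|j]]; first exact: ideal_pow0.
    rewrite coefZ coefX mulr1; apply: sub_ideal_gen.
    exists [:: signed_minor phi i]; rewrite big_seq1; split=> // z.
    by rewrite inE => /eqP ->; apply: signed_minor_mem.
  by rewrite coefZ coefX mulr0; exact: (ideal0 (ideal_gen_ideal _)).
- by rewrite /rees_map rmorphD; apply: rpredD.
- by rewrite /rees_map rmorphM; apply: rpredM.
Qed.

Definition rees_proj (F : T) : rees_algebra (minor_ideal phi 2) :=
  ReesElt (rees_map_pred F).

Fact rees_proj_zmod_morphism : zmod_morphism rees_proj.
Proof. by move=> F G; apply: val_inj; rewrite /= /rees_map rmorphB. Qed.

Fact rees_proj_monoid_morphism : monoid_morphism rees_proj.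
Proof.
split; first by apply: val_inj; rewrite /= /rees_map rmorph1.
by move=> F G; apply: val_inj; rewrite /= /rees_map rmorphM.
Qed.

HB.instance Definition _ :=
  GRing.isZmodMorphism.Build T (rees_algebra (minor_ideal phi 2)) rees_proj
    rees_proj_zmod_morphism.
HB.instance Definition _ :=
  GRing.isMonoidMorphism.Build T (rees_algebra (minor_ideal phi 2)) rees_proj
    rees_proj_monoid_morphism.

Lemma rees_proj_eq0 F : rees_proj F = 0 <-> rees_ideal phi F.
Proof.
by split=> [/(congr1 val)|E]; [|apply: val_inj].
Qed.

Lemma rees_proj_surj q : exists F, rees_proj F = q.
Proof.
suff H : forall p : {poly R}, p \in rees_pred (minor_ideal phi 2) ->
    exists F, rees_map phi F = p.
  by have [F EF] := H _ (valP q); exists F; apply: val_inj.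
pose Im (p : {poly R}) := exists F, rees_map phi F = p.
have ImD p q' : Im p -> Im q' -> Im (p + q').
  by move=> [F <-] [G <-]; exists (F + G); rewrite /rees_map rmorphD.
have ImM p q' : Im p -> Im q' -> Im (p * q').
  by move=> [F <-] [G <-]; exists (F * G); rewrite /rees_map rmorphM.
have ImC c : Im c%:P by exists c%:MP; rewrite rees_mapC.
(* For fixed [i] these coefficients form an ideal of [R], so it is enough to reach the products of
   [i] elements of the minor ideal. *)
have Im_ideal i : is_ideal [set c : R | Im (c *: 'X^i)].
  split=> [|c d|c d] /=.
  - by rewrite scale0r; apply: (ImC 0).
  - by rewrite scalerDl; apply: ImD.
  - by move=> Id; rewrite -scalerA -mul_polyC; apply: ImM.
have ImI c : minor_ideal phi 2 c -> Im (c *: 'X).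
  apply: (minor2_ideal_min (Im_ideal 1%N)) => i.
  by exists 'X_i; rewrite rees_mapX.
have ImP i c : ideal_pow (minor_ideal phi 2) i c -> Im (c *: 'X^i).
  apply: (ideal_gen_sub (Im_ideal i)) => z [s [<- Hs ->]] /=.
  elim: s Hs => [|d s IH] Hs; first by rewrite big_nil scale1r; apply: (ImC 1).
  rewrite big_cons /= exprS -scalerA scalerAr scalerAl; apply: ImM.
    by apply: ImI; apply: Hs; rewrite mem_head.
  by apply: IH => z' zs; apply: Hs; rewrite in_cons zs orbT.
move=> p /asboolP Hp; rewrite -[p]coefK poly_def.
rewrite -/(Im _); elim/big_ind: _ => [||i _]; [exact: (ImC 0)|exact: ImD|exact: ImP].
Qed.

End Setting.

(** * Regular sequences and linear forms *)

(* Modulo [x], [f] becomes [y^m s], and [g + s h] avoids the primes [(x, y)] and [(x, s)]. *)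
Lemma grade_mod_x (T : idomainType) (e_x e_xy e_xs : {rmorphism T -> T})
    (x y s f g h : T) m :
  (forall F, e_x F = 0 <-> exists G, F = G * x) ->
  (forall F, e_xy F = 0 <-> exists G H, F = G * x + H * y) ->
  (forall F, e_xs F = 0 <-> exists G H, F = G * x + H * s) ->
  e_x y != 0 -> e_x s != 0 -> e_xy s != 0 -> (exists u, f = u * x + y ^+ m * s) ->
  e_xs g != 0 -> e_xy g = 0 -> e_xy h != 0 ->
  relreg (addgen [set 0] x) [:: f; g + s * h].
Proof.
move=> kx kxy kxs y_x s_x s_xy [u0 Ef] g_xs g_xy h_xy.
have Ix F : addgen [set 0] x F <-> e_x F = 0 by rewrite addgen0E kx.
have xx : e_x x = 0 by apply/kx; exists 1; rewrite mul1r.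
have xs_x : e_xs x = 0 by apply/kxs; exists 1, 0; rewrite mul1r mul0r addr0.
have xs_s : e_xs s = 0 by apply/kxs; exists 0, 1; rewrite mul1r mul0r add0r.
have xy_x : e_xy x = 0 by apply/kxy; exists 1, 0; rewrite mul1r mul0r addr0.
have fx : e_x f != 0.
  by rewrite Ef rmorphD !rmorphM rmorphXn xx mulr0 add0r mulf_neq0 // expf_neq0.
set w := g + s * h.
have w_xy : e_xy w != 0 by rewrite rmorphD rmorphM g_xy add0r mulf_neq0.
have w_xs : e_xs w != 0 by rewrite rmorphD rmorphM xs_s mul0r addr0.
split=> [F /Ix|]; first by rewrite rmorphM => /eqP; rewrite mulf_eq0 (negbTE fx) => /eqP/Ix.
split=> // F.
(* The maps [e_x], [e_xy], [e_xs] land in a domain, so [(x)], [(x, y)] and [(x, s)] are prime.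
   Dividing by [y] modulo [x] shows [w] regular modulo every [(x, y^j)]; dividing by [s] in the same
   way then reaches [(x, y^m s)]. *)
pose Iy j G := exists u v, G = u * x + v * y ^+ j.
have xy_reg j G : Iy j (w * G) -> Iy j G.
  elim: j G => [|j IH] G; first by exists 0, G; rewrite mul0r add0r mulr1.
  move=> [u [v E]].
  have /kxy[u' [v' EG]] : e_xy G = 0.
    have /eqP : e_xy (w * G) = 0.
      by apply/kxy; exists u, (v * y ^+ j); rewrite E exprSr mulrA.
    by rewrite rmorphM mulf_eq0 (negbTE w_xy) => /eqP.
  have /kx[d Ed] : e_x (w * v' - v * y ^+ j) = 0.
    have /eqP : e_x ((w * v' - v * y ^+ j) * y) = 0.
      apply/kx; exists (u - w * u'); rewrite EG in E.
      have -> : (w * v' - v * y ^+ j) * y = w * (u' * x + v' * y) - w * u' * x - v * y ^+ j.+1.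
        by rewrite exprSr; ring.
      by rewrite E; ring.
    by rewrite rmorphM mulf_eq0 (negbTE y_x) orbF => /eqP.
  have [|u2 [v2 E2]] := IH v'.
    by exists d, v; rewrite -Ed subrK.
  by exists (u' + u2 * y), v2; rewrite EG E2 exprSr; ring.
have If G : addgen (addgen [set 0] x) f G <-> exists u v, G = u * x + v * (y ^+ m * s).
  split=> [[v]|[u [v ->]]].
    rewrite addgen0E => -[u E]; exists (u + v * u0), v.
    by rewrite -[G](subrK (v * f)) E Ef; ring.
  by exists v; rewrite addgen0E; exists (u - v * u0); rewrite Ef; ring.
move=> /If [u [v E]].
have /kxs[u' [v' EF]] : e_xs F = 0.
  have /eqP : e_xs (w * F) = 0.
    by apply/kxs; exists u, (v * y ^+ m); rewrite E; ring.
  by rewrite rmorphM mulf_eq0 (negbTE w_xs) => /eqP.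
have /kx[d Ed] : e_x (w * v' - v * y ^+ m) = 0.
  have /eqP : e_x ((w * v' - v * y ^+ m) * s) = 0.
    apply/kx; exists (u - w * u'); rewrite EF in E.
    have -> : (w * v' - v * y ^+ m) * s
      = w * (u' * x + v' * s) - w * u' * x - v * (y ^+ m * s) by ring.
    by rewrite E; ring.
  by rewrite rmorphM mulf_eq0 (negbTE s_x) orbF => /eqP.
have [|u2 [v2 E2]] := xy_reg m v'.
  by exists d, v; rewrite -Ed subrK.
by apply/If; exists (u' + u2 * s), v2; rewrite EF E2; ring.
Qed.

Section LinearForm.
Variables (A : idomainType) (q d s : A).
Hypotheses (q_neq0 : q != 0) (d_regular : regmod (addgen [set 0] q) d).
Hypotheses (q_dvd_s : addgen [set 0] q s).

Local Notation ell := (s%:P%:P * 'X + d%:P%:P * 'X%:P : {poly {poly A}}).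

(** Modulo [q] the form reduces to [d] times a variable, which is regular, so [q] divides [v] and
    cancels. In the application [q] is [p3], [d] is [Delta] and [s] is [x^m p3]. *)
Lemma linear_form_divl (u v : {poly {poly A}}) :
  q%:P%:P * u = v * ell -> exists w, u = w * ell.
Proof.
have H0 := is_ideal0 A; have HI := addgen_ideal q H0.
have HE := extI_ideal (extI_ideal HI).
have EE : extI (extI (addgen [set 0] q)) = addgen [set 0] q%:P%:P.
  by rewrite -extI_addgen // -extI_addgen ?extI0 //; apply: is_ideal0.
move=> E; have Ev : extI (extI (addgen [set 0] q)) v.
  have regX : regmod (extI (addgen [set 0] q)) 'X.
    by apply: unit_lead_regmod => //; exists 1; rewrite lead_coefX mulr1.
  apply: (extI_regmod (extI_regmod d_regular)); apply: (extI_regmod regX).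
  have -> : 'X%:P * (d%:P%:P * v) = v * ell - s%:P%:P * ('X * v) by ring.
  rewrite -E; apply: (idealB HE).
    by apply: (idealMr _ HE); rewrite EE; apply: addgen_mem; apply: is_ideal0.
  apply: (idealMr _ HE); apply/extI_polyC; first exact: extI_ideal.
  exact/extI_polyC.
move: Ev; rewrite EE addgen0E => -[w Ew]; exists w.
apply: (@mulfI _ q%:P%:P); first by rewrite !polyC_eq0.
by rewrite E Ew; ring.
Qed.

Lemma linear_form_divXl j (u v : {poly {poly A}}) :
  (q%:P%:P) ^+ j * u = v * ell -> exists w, u = w * ell.
Proof.
elim: j u v => [|j IH] u v; first by rewrite mul1r; exists v.
by rewrite exprSr -mulrA => /IH[w /linear_form_divl].
Qed.

End LinearForm.

(** * The defining ideal of the Rees algebra *)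

(* [T] is used through the universal property of [R[t0, t1, t2]] only, as unification
   is very slow on nested multivariate polynomials. *)
Record polynomial_ring3 (R T : idomainType) (C : {rmorphism R -> T}) (t0 t1 t2 : T) : Prop :=
  PolynomialRing3 {
    poly3_ind : forall P : T -> Prop, (forall q, P (C q)) -> P t0 -> P t1 -> P t2 ->
      (forall F G, P F -> P G -> P (F + G)) -> (forall F G, P F -> P G -> P (F * G)) ->
      forall F, P F;
    poly3_eval : forall (S : comNzRingType) (f : {rmorphism R -> S}) (u0 u1 u2 : S),
      exists e : {rmorphism T -> S},
        [/\ forall q, e (C q) = f q, e t0 = u0, e t1 = u1 & e t2 = u2] }.

Section ReesIdeal.
Variables (R T : idomainType) (C : {rmorphism R -> T}) (t0 t1 t2 : T).
Hypothesis polyT : polynomial_ring3 C t0 t1 t2.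

Lemma poly3_mod (e : {rmorphism T -> T}) (I : set T) :
  is_ideal I -> (forall q, I (e (C q) - C q)) -> I (e t0 - t0) -> I (e t1 - t1) ->
  I (e t2 - t2) -> forall F, I (e F - F).
Proof.
move=> HI IC I0 I1 I2; apply: (poly3_ind polyT) => // F G IF IG.
  have -> : e (F + G) - (F + G) = (e F - F) + (e G - G) by rewrite rmorphD; ring.
  exact: idealD.
have -> : e (F * G) - F * G = (e F - F) * e G + F * (e G - G) by rewrite rmorphM; ring.
by apply: idealD => //; [apply: idealMr|apply: idealM].
Qed.

Definition lincomb (q0 q1 q2 : R) : T := t0 * C q0 + t1 * C q1 + t2 * C q2.

Lemma lincomb_eq0 q0 q1 q2 : lincomb q0 q1 q2 = 0 -> [/\ q0 = 0, q1 = 0 & q2 = 0].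
Proof.
move=> E; have H u0 u1 u2 : u0 * q0 + u1 * q1 + u2 * q2 = 0.
  have [e [eC e0 e1 e2]] := poly3_eval polyT (idfun : {rmorphism R -> R}) u0 u1 u2.
  have := congr1 e E; rewrite /lincomb 2!(rmorphD e) 3!(rmorphM e) !eC e0 e1 e2.
  by rewrite rmorph0.
split; [have := H 1 0 0|have := H 0 1 0|have := H 0 0 1];
  by rewrite !mul0r mul1r ?addr0 ?add0r.
Qed.

Lemma C_inj : injective C.
Proof.
move=> q r E; have [e [eC _ _ _]] := poly3_eval polyT (idfun : {rmorphism R -> R}) 0 0 0.
by have := congr1 e E; rewrite !eC.
Qed.

Lemma C_eq0 q : (C q == 0) = (q == 0).
Proof. by rewrite -(inj_eq C_inj) rmorph0. Qed.

Lemma var_neq0 : [/\ t0 != 0, t1 != 0 & t2 != 0].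
Proof.
have [e [_ e0 e1 e2]] := poly3_eval polyT (idfun : {rmorphism R -> R}) 1 1 1.
by split; apply/eqP => E; move: e0 e1 e2; rewrite E rmorph0 => /eqP + /eqP + /eqP;
  rewrite ?(eq_sym 0) ?oner_eq0.
Qed.

Variables (x y : R) (kill_x kill_xy : {rmorphism R -> R}).
Hypotheses (kill_x_mod : forall q, addgen [set 0] x (kill_x q - q))
  (kill_xx : kill_x x = 0) (kill_xy_neq0 : kill_x y != 0).
Hypotheses (kill_xy_mod : forall q, addgen (addgen [set 0] x) y (kill_xy q - q))
  (kill_xy_x : kill_xy x = 0) (kill_xy_y : kill_xy y = 0).
Hypothesis x_neq0 : x != 0.

(** An endomorphism of the domain [T] with kernel [(x)] serves as the reduction modulo [x], and
    shows that this ideal is prime. The next two lemmas do the same for [(x, y)] and [(x, t1)]. *)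
Lemma mod_x_exists : exists e : {rmorphism T -> T},
  [/\ forall q, e (C q) = C (kill_x q), e t0 = t0, e t1 = t1, e t2 = t2 &
      forall F, e F = 0 <-> exists G, F = G * C x].
Proof.
have [e [eC e0 e1 e2]] := poly3_eval polyT (C \o kill_x : {rmorphism R -> T}) t0 t1 t2.
exists e; split=> // F; have H0 := is_ideal0 T; have HI := addgen_ideal (C x) H0.
split=> [E|[G ->]]; last by rewrite rmorphM eC /= kill_xx rmorph0 mulr0.
have : addgen [set 0] (C x) (e F - F).
  apply: poly3_mod; rewrite ?e0 ?e1 ?e2 ?subrr //; try exact: ideal0.
  move=> q; rewrite eC /= -rmorphB; have := kill_x_mod q; rewrite !addgen0E => -[d ->].
  by exists (C d); rewrite rmorphM.
by rewrite E sub0r addgen0E => -[d Ed]; exists (- d); rewrite mulNr -Ed opprK.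
Qed.

Lemma mod_xy_exists : exists e : {rmorphism T -> T},
  [/\ forall q, e (C q) = C (kill_xy q), e t0 = t0, e t1 = t1, e t2 = t2 &
      forall F, e F = 0 <-> exists G H, F = G * C x + H * C y].
Proof.
have [e [eC e0 e1 e2]] := poly3_eval polyT (C \o kill_xy : {rmorphism R -> T}) t0 t1 t2.
exists e; split=> // F.
have H0 := is_ideal0 T; have H1 := addgen_ideal (C x) H0; have HI := addgen_ideal (C y) H1.
split=> [E|[G [H ->]]]; last first.
  by rewrite rmorphD !rmorphM !eC /= kill_xy_x kill_xy_y rmorph0 !mulr0 addr0.
have : addgen (addgen [set 0] (C x)) (C y) (e F - F).
  apply: poly3_mod; rewrite ?e0 ?e1 ?e2 ?subrr //; try exact: ideal0.
  move=> q; rewrite eC /= -rmorphB; have [r] := kill_xy_mod q.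
  rewrite !addgen0E => -[d Ed]; exists (C r), (C d).
  by rewrite -!rmorphM -rmorphB Ed.
rewrite E sub0r => -[r]; rewrite addgen0E => -[d Ed].
exists (- d), (- r); rewrite -[F]opprK -[in LHS](subrK (r * C y) (- F)) Ed; ring.
Qed.

Lemma mod_xt_exists : exists e : {rmorphism T -> T},
  [/\ forall q, e (C q) = C (kill_x q), e t0 = t0, e t1 = 0, e t2 = t2 &
      forall F, e F = 0 <-> exists G H, F = G * C x + H * t1].
Proof.
have [e [eC e0 e1 e2]] := poly3_eval polyT (C \o kill_x : {rmorphism R -> T}) t0 0 t2.
exists e; split=> // F.
have H0 := is_ideal0 T; have H1 := addgen_ideal (C x) H0; have HI := addgen_ideal t1 H1.
split=> [E|[G [H ->]]]; last first.
  by rewrite rmorphD !rmorphM !eC e1 /= kill_xx rmorph0 !mulr0 addr0.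
have : addgen (addgen [set 0] (C x)) t1 (e F - F).
  apply: poly3_mod; rewrite ?e0 ?e1 ?e2 ?subrr //; try exact: ideal0.
    move=> q; rewrite eC /= -rmorphB; apply: sub_addgen.
    have := kill_x_mod q; rewrite !addgen0E => -[d ->].
    by exists (C d); rewrite rmorphM.
  by rewrite sub0r; apply: idealN => //; apply: addgen_mem.
rewrite E sub0r => -[r]; rewrite addgen0E => -[d Ed].
exists (- d), (- r); rewrite -[F]opprK -[in LHS](subrK (r * t1) (- F)) Ed; ring.
Qed.

Variables (m n : nat) (p1 p2 p3 a1 a2 a3 b1 b2 b3 : R).
Local Notation Delta := (x ^+ m * p2 - y ^+ m * p1).
Hypotheses (n_gt0 : (0 < n)%N) (le_nm : (n <= m)%N).
Hypotheses (p1E : p1 = a1 * x ^+ m + b1 * y ^+ n)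
  (p2E : p2 = a2 * x ^+ m + b2 * y ^+ n) (p3E : p3 = a3 * x ^+ m + b3 * y ^+ n).
Hypotheses (p3_neq0 : p3 != 0) (Delta_regular : regmod (addgen [set 0] p3) Delta).
Hypothesis (x_coprime : ~ (kill_x p1 = 0 /\ kill_x p3 = 0)).

Local Notation c := (C (y ^+ (m - n)) * t1).
Local Notation a := (lincomb a1 a2 a3).
Local Notation b := (lincomb b1 b2 b3).
Local Notation X := (C (x ^+ m)).
Local Notation Y := (C (y ^+ n)).
Local Notation f := (t0 * X + c * Y).
Local Notation g := (a * X + b * Y).
Local Notation h := (t0 * b - c * a).
Local Notation J := (hb_ideal t0 c a b X Y [set 0]).

Hypothesis h_mod_xy : ~ exists G H, h = G * C x + H * C y.

Let m_gt0 : (0 < m)%N. Proof. exact: leq_trans le_nm. Qed.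

Lemma f_lincomb : f = lincomb (x ^+ m) (y ^+ m) 0.
Proof.
rewrite /lincomb rmorph0 mulr0 addr0.
have -> : C (y ^+ m) = C (y ^+ (m - n)) * Y by rewrite -rmorphM -exprD subnK.
by ring.
Qed.

Lemma g_lincomb : g = lincomb p1 p2 p3.
Proof.
have CE q r : C (q * x ^+ m + r * y ^+ n) = C q * X + C r * Y.
  by rewrite (rmorphD C) !(rmorphM C).
by rewrite p1E p2E p3E /lincomb !CE; ring.
Qed.

Lemma f_neq0 : f != 0.
Proof.
rewrite f_lincomb; apply/eqP => /lincomb_eq0[/eqP].
by rewrite expf_eq0 (negbTE x_neq0) andbF.
Qed.

Lemma fJ : J f.
Proof. by exists 1, 0, 0; rewrite mul1r !mul0r !addr0 subrr. Qed.

Lemma gJ : J g.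
Proof. by exists 0, 1, 0; rewrite mul1r !mul0r addr0 add0r subrr. Qed.

Lemma x_regular : regmod J (C x).
Proof.
have H0 := is_ideal0 T; have [_ t1nz _] := var_neq0.
have [ex [exC ex0 ex1 ex2 kx]] := mod_x_exists.
have [exy [exyC exy0 exy1 exy2 kxy]] := mod_xy_exists.
have [ext [extC ext0 ext1 ext2 kxt]] := mod_xt_exists.
(* As [g] vanishes modulo [(x, y)], the summand [t1 * h] keeps the second element outside that
   prime; the factor [t1] leaves it equal to [g] modulo [(x, t1)]. *)
apply: (@hb_regmod T t0 c a b X Y [set 0] (C x) f (g + t1 * h) H0 fJ).
- by exists 0, 1, t1; rewrite mul0r mul1r add0r subrr.
- by move=> F /= /eqP; rewrite mulf_eq0 C_eq0 (negbTE x_neq0) => /eqP.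
apply: (@grade_mod_x T ex exy ext (C x) (C y) t1 f g h m) => //.
- by rewrite exC C_eq0.
- by rewrite ex1.
- by rewrite exy1.
- exists (t0 * C (x ^+ m.-1)); rewrite f_lincomb /lincomb rmorph0 mulr0 addr0.
  have -> : X = C (x ^+ m.-1) * C x by rewrite -rmorphM -exprSr prednK.
  by rewrite (rmorphXn C m) /=; ring.
- apply/eqP; rewrite g_lincomb /lincomb 2!(rmorphD ext) 3!(rmorphM ext) !extC ext0 ext1 ext2.
  rewrite mul0r addr0 => E; apply: x_coprime.
  have [|] := @lincomb_eq0 (kill_x p1) 0 (kill_x p3); last by [].
  by rewrite /lincomb rmorph0 mulr0 addr0.
- have Ep q r : kill_xy (q * x ^+ m + r * y ^+ n) = 0.
    rewrite rmorphD !rmorphM !rmorphXn kill_xy_x kill_xy_y !expr0n.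
    by rewrite !gtn_eqF // !mulr0 addr0.
  rewrite g_lincomb /lincomb 2!(rmorphD exy) 3!(rmorphM exy) !exyC.
  by rewrite p1E p2E p3E !Ep rmorph0 !mulr0 !addr0.
- by apply/eqP => /kxy /h_mod_xy.
Qed.

Lemma x_regularX j F : J (C x ^+ j * F) -> J F.
Proof. by elim: j F => [|j IH] F; rewrite ?mul1r // exprS -(mulrA (C x)) => /x_regular/IH. Qed.

(** Modulo [x], [f] becomes [y^m t1], which is nonzero, so [x] must divide the cofactor of [f]. *)
Lemma x_regular_mod_f F : addgen [set 0] f (C x * F) -> addgen [set 0] f F.
Proof.
have [ex [exC ex0 ex1 ex2 kx]] := mod_x_exists; have [_ t1nz _] := var_neq0.
rewrite !addgen0E => -[v E].
have /kx[w Ew] : ex v = 0.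
  have /eqP : ex (v * f) = 0 by rewrite -E rmorphM exC kill_xx rmorph0 mul0r.
  rewrite rmorphM mulf_eq0 f_lincomb /lincomb rmorph0 mulr0 addr0 rmorphD !rmorphM !exC.
  rewrite !rmorphXn kill_xx (rmorph0 C) expr0n gtn_eqF // mulr0 add0r ex1.
  by rewrite mulf_eq0 expf_eq0 C_eq0 (negbTE t1nz) (negbTE kill_xy_neq0) andbF !orbF => /eqP.
exists w; apply: (@mulfI _ (C x)); first by rewrite C_eq0.
by rewrite E Ew; ring.
Qed.

Lemma x_regularX_mod_f j F : addgen [set 0] f (C x ^+ j * F) -> addgen [set 0] f F.
Proof.
elim: j F => [|j IH] F; first by rewrite mul1r.
by rewrite exprS -(mulrA (C x)) => H; exact: (IH _ (x_regular_mod_f H)).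
Qed.

Local Notation U := {poly {poly R}}.

Definition iota_t : {rmorphism U -> T} := eval_poly (eval_poly C t1) t2.

Lemma iotaC q : iota_t q%:P%:P = C q.
Proof. by rewrite /iota_t !eval_polyC. Qed.

Lemma iotaXY : iota_t 'X%:P = t1 /\ iota_t 'X = t2.
Proof.
by split; rewrite /iota_t; [rewrite eval_polyC|]; exact: eval_polyX.
Qed.

(** Modulo [f], [x^m t0] equals [- y^m t1], so powers of [x] clear [t0] away. *)
Lemma eliminate_t0 F : exists M (u : U) w, C x ^+ M * F = iota_t u + w * f.
Proof.
elim/(poly3_ind polyT): F => [q||||F G [M [u [w EF]]] [N [v [z EG]]]
  |F G [M [u [w EF]]] [N [v [z EG]]]].
- by exists 0%N, q%:P%:P, 0; rewrite iotaC mul1r mul0r addr0.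
- exists m, (- ((y ^+ m)%:P%:P * 'X%:P)), 1.
  rewrite rmorphN rmorphM iotaC iotaXY.1 f_lincomb /lincomb (rmorph0 C) !(rmorphXn C) /=.
  by ring.
- by exists 0%N, 'X%:P, 0; rewrite iotaXY.1 mul1r mul0r addr0.
- by exists 0%N, 'X, 0; rewrite iotaXY.2 mul1r mul0r addr0.
- exists (M + N)%N, ((x%:P%:P) ^+ N * u + (x%:P%:P) ^+ M * v), (C x ^+ N * w + C x ^+ M * z).
  have -> : C x ^+ (M + N) * (F + G) = C x ^+ N * (C x ^+ M * F) + C x ^+ M * (C x ^+ N * G).
    by rewrite exprD; ring.
  rewrite EF EG [iota_t (_ + _)]rmorphD !(rmorphM iota_t) !(rmorphXn iota_t) /= iotaC.
  by ring.
- exists (M + N)%N, (u * v), (w * (C x ^+ N * G) + iota_t u * z).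
  have -> : C x ^+ (M + N) * (F * G) = (C x ^+ M * F) * (C x ^+ N * G).
    by rewrite exprD; ring.
  by rewrite EF EG (rmorphM iota_t); ring.
Qed.

(** The substitution [e] parametrizes [f = 0]. It kills only the multiples of [f], because [t0] can
    be eliminated and [x] is regular modulo [f]; it lands in a domain, where the image of [g] is
    nonzero. *)
Lemma f_g_regular : regmod (addgen [set 0] f) g.
Proof.
have [e [eC e0 e1 e2]] := poly3_eval polyT (polyC \o polyC : {rmorphism R -> U})
  (- ((y ^+ m)%:P%:P * 'X%:P)) ((x ^+ m)%:P%:P * 'X%:P) 'X.
have ef : e f = 0.
  rewrite f_lincomb /lincomb 2!(rmorphD e) 3!(rmorphM e) !eC e0 e1 e2 /= !rmorph0.
  by ring.
have eg : e g != 0.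
  rewrite g_lincomb /lincomb 2!(rmorphD e) 3!(rmorphM e) !eC e0 e1 e2 /=.
  (* The coefficient of [t2] in the image of [g] is [p3]. *)
  apply/eqP => /(congr1 (fun p : U => p`_1)).
  have -> : - ((y ^+ m)%:P%:P * 'X%:P) * p1%:P%:P + (x ^+ m)%:P%:P * 'X%:P * p2%:P%:P =
    (Delta%:P * 'X)%:P :> U by rewrite !rmorphM !rmorphB !rmorphM /=; ring.
  rewrite coefD coefC add0r coefXM coefC coef0 /= => /eqP.
  by rewrite polyC_eq0 (negbTE p3_neq0).
move=> F; rewrite {1}addgen0E => -[v E].
have eF : e F = 0.
  have /eqP : e (g * F) = 0 by rewrite E rmorphM ef mulr0.
  by rewrite rmorphM mulf_eq0 (negbTE eg) => /eqP.
have [M [u [w Eu]]] := eliminate_t0 F.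
apply: (@x_regularX_mod_f M); rewrite addgen0E; exists w; rewrite Eu.
suff -> : u = 0 by rewrite rmorph0 add0r.
have eiu : e (iota_t u) = 0.
  have := congr1 e Eu; rewrite rmorphD !rmorphM eF ef !mulr0 addr0.
  by move=> <-.
have q_size : (1 < size (x ^+ m *: 'X : {poly R})%R)%N.
  by rewrite size_scale ?size_polyX // expf_neq0.
(* On [R[t1, t2]] the map is the substitution of [x^m t1] for [t1], which is injective. *)
have E2 : e (iota_t u) = map_poly (comp_poly (x ^+ m *: 'X)) u.
  apply: (@poly_rmorph_ext _ _ (e \o iota_t) (map_poly (comp_poly (x ^+ m *: 'X)))).
    move=> q /=; rewrite map_polyC /=.
    apply: (@poly_rmorph_ext _ _ (e \o iota_t \o polyC) (polyC \o comp_poly (x ^+ m *: 'X)))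
      => [r|] /=.
      by rewrite iotaC eC /= comp_polyC.
    by rewrite iotaXY.1 e1 comp_polyX -mul_polyC rmorphM.
  by rewrite /= iotaXY.2 e2 map_polyX.
apply/polyP => i; move/polyP/(_ i): eiu; rewrite E2 coef_map /= !coef0 => /eqP.
by rewrite comp_poly_eq0 // => /eqP.
Qed.

Section Kernel.
Variable rho : {rmorphism T -> {poly R}}.
Hypotheses (rhoC : forall q, rho (C q) = q%:P)
  (rho0 : rho t0 = (y ^+ m * p3) *: 'X) (rho1 : rho t1 = (- (x ^+ m * p3)) *: 'X)
  (rho2 : rho t2 = Delta *: 'X).

Lemma rho_lincomb q1 q2 q3 : rho (lincomb q1 q2 q3) =
  (y ^+ m * p3 * q1 - x ^+ m * p3 * q2 + Delta * q3) *: 'X.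
Proof.
rewrite /lincomb 2!(rmorphD rho) 3!(rmorphM rho) !rhoC rho0 rho1 rho2 -!mul_polyC.
by rewrite !(rmorphD polyC) !(rmorphN polyC) !(rmorphM polyC); ring.
Qed.

Lemma rho_f : rho f = 0.
Proof. by rewrite f_lincomb rho_lincomb -[RHS](scale0r 'X); congr (_ *: _); ring. Qed.

Lemma rho_g : rho g = 0.
Proof. by rewrite g_lincomb rho_lincomb -[RHS](scale0r 'X); congr (_ *: _); ring. Qed.

Lemma rho_h : rho h = 0.
Proof.
have : rho (X * h) = 0.
  have -> : X * h = b * f - c * g by ring.
  by rewrite rmorphB !rmorphM rho_f rho_g !mulr0 subrr.
move/eqP; rewrite rmorphM rhoC mulf_eq0 polyC_eq0 expf_eq0 (negbTE x_neq0) andbF.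
by move/eqP.
Qed.

(** Pseudo-division by [ell] in [t2] leaves a remainder in [R[t1]], on which [rho] is injective, so
    the remainder is zero. The multiplier is a power of [x^m p3], from which [p3] is removed because
    [Delta] is regular modulo it. *)
Lemma rho_iota_kernel u : rho (iota_t u) = 0 ->
  exists j w, (x%:P%:P) ^+ j * u =
    w * ((x ^+ m * p3)%:P%:P * 'X + Delta%:P%:P * 'X%:P).
Proof.
set s := x ^+ m * p3; set ell := s%:P%:P * 'X + _ => Eu.
have s_nz : s != 0 by rewrite mulf_neq0 // expf_neq0.
have rho_ell : rho (iota_t ell) = 0.
  rewrite /ell (rmorphD iota_t) !(rmorphM iota_t) iotaXY.1 iotaXY.2 !iotaC.
  rewrite !(rmorphD rho) !(rmorphM rho).
  rewrite !rhoC rho1 rho2 -/s -!mul_polyC !(rmorphN polyC).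
  ring.
have ellE : ell = s%:P *: 'X + (Delta%:P * 'X)%:P.
  by rewrite /ell -mul_polyC (rmorphM polyC Delta%:P 'X).
have size_ell : size ell = 2.
  have sX : size (s%:P *: 'X : U) = 2 by rewrite size_scale ?polyC_eq0 // size_polyX.
  by rewrite ellE size_polyDl sX // (leq_ltn_trans (size_polyC_leq1 _)).
have lead_ell : lead_coef ell = s%:P.
  rewrite lead_coefE size_ell ellE coefD coefZ coefX mulr1 coefC addr0.
  by [].
set e := Pdiv.Idomain.scalp u ell.
have := Pdiv.Idomain.divp_eq u ell; rewrite lead_ell -/e.
set q := Pdiv.Idomain.divp _ _; set r := Pdiv.Idomain.modp _ _ => Ediv.
have size_r : (size r <= 1)%N.
  have ell_nz : ell != 0 by rewrite -size_poly_eq0 size_ell.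
  by have := Pdiv.Idomain.ltn_modp u ell; rewrite size_ell ell_nz.
have r0 : r = 0.
  rewrite (size1_polyC size_r); set r' := r`_0.
  have : rho (iota_t r'%:P) = 0.
    have -> : r'%:P = s%:P ^+ e *: u - q * ell by rewrite Ediv -(size1_polyC size_r) addrC addKr.
    by rewrite -mul_polyC !rmorphB !rmorphM Eu rho_ell !mulr0 subrr.
  have -> : rho (iota_t r'%:P) = r' \Po ((- s) *: 'X).
    apply: (@poly_rmorph_ext _ _ (rho \o iota_t \o polyC) (comp_poly ((- s) *: 'X)))
      => [d|] /=; first by rewrite iotaC rhoC comp_polyC.
    by rewrite iotaXY.1 rho1 comp_polyX.
  move/eqP; rewrite comp_poly_eq0; last by rewrite size_scale ?oppr_eq0 // size_polyX.
  by move/eqP ->; rewrite polyC0.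
have {Ediv} : (p3%:P%:P) ^+ e * ((x%:P%:P) ^+ (m * e) * u) = q * ell.
  have sE : s%:P%:P = x%:P%:P ^+ m * p3%:P%:P :> U.
    by rewrite /s (rmorphM polyC) (rmorphXn polyC) (rmorphM polyC) (rmorphXn polyC).
  rewrite -[RHS]addr0 -[X in _ + X]r0 -Ediv -mul_polyC (rmorphXn polyC) /= sE.
  by rewrite exprMn -exprM mulrA [in LHS](mulrC (p3%:P%:P ^+ e)).
move=> /(@linear_form_divXl R p3 Delta s p3_neq0 Delta_regular _)[|w Ew].
  by rewrite addgen0E; exists (x ^+ m).
by exists (m * e)%N, w.
Qed.

Lemma rees_kernel F : rho F = 0 <-> J F.
Proof.
split=> [E|[u [v [w /subr0_eq ->]]]]; last first.
  by rewrite 2!(rmorphD rho) 3!(rmorphM rho) rho_f rho_g rho_h !mulr0 !addr0.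
have HJ : is_ideal J by apply/hb_ideal_ideal/is_ideal0.
have [M [u [w Eu]]] := eliminate_t0 F.
have /rho_iota_kernel[j [v Ev]] : rho (iota_t u) = 0.
  have := congr1 rho Eu; rewrite rmorphM E mulr0 rmorphD rmorphM rho_f mulr0 addr0.
  by move=> <-.
apply: (@x_regularX (j + M)).
have -> : C x ^+ (j + M) * F = iota_t ((x%:P%:P) ^+ j * u) + C x ^+ j * w * f.
  by rewrite exprD -mulrA Eu (rmorphM iota_t) (rmorphXn iota_t) /= iotaC; ring.
rewrite Ev; apply: (idealD HJ); last by apply: (idealM _ HJ); apply: fJ.
rewrite (rmorphM iota_t); apply: (idealM _ HJ).
(* Eliminating [t0] from [f] and [g] by hand produces exactly the linear form spanning the
   kernel. *)
have -> : iota_t ((x ^+ m * p3)%:P%:P * 'X + Delta%:P%:P * 'X%:P) = X * g - C p1 * f.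
  rewrite f_lincomb g_lincomb /lincomb (rmorph0 C) rmorphD !(rmorphM iota_t) !iotaC.
  by rewrite iotaXY.1 iotaXY.2 (rmorphB C) !(rmorphM C); ring.
by apply: (idealB HJ); apply: (idealM _ HJ); [apply: gJ|apply: fJ].
Qed.

End Kernel.

End ReesIdeal.

(** * Primary components and iterated polynomial rings *)

Section PrimaryComponent.
Variable S : comNzRingType.

Lemma ideal_exprD (Q : set S) a b e :
  is_ideal Q -> Q (a ^+ e) -> Q (b ^+ e) -> Q ((a + b) ^+ (e + e)).
Proof.
move=> HQ Qa Qb; rewrite exprDn; apply: ideal_sum => // i _.
rewrite -mulr_natl; apply: idealM => //.
case: (leqP e i) => [le|/ltnW le].
  by rewrite -(subnK le) exprD; apply: idealM => //; apply: idealM.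
by rewrite -addnBA // addnC exprD; apply: idealMr => //; apply: idealM.
Qed.

(** A substitute for localizing at [P]. The radical of any other component contains [P] and differs
    from it, so that component contains an element outside [P]; the product of these elements
    carries [K] into every component. *)
Lemma primary_component_multiplier (J P K : set S) :
  is_primary_component J P K -> is_prime P ->
  (forall Q, is_primary Q -> J `<=` Q -> P `<=` radical Q) ->
  exists2 s, ~ P s & forall c, K c -> J (s * c).
Proof.
move=> [r [Q [[primQ JE radQ _] [i [Pi Ki]]]]] HP minP.
have JQ j : J `<=` Q j by move=> z; rewrite JE => /(_ j).
have HQ j : is_ideal (Q j) by case: (primQ j).
have /choice[w Hw] (j : 'I_r) : exists z, ~ P z /\ (j != i -> Q j z).
  have [->|nij] := eqVneq j i; first by exists 1; split=> //; case: HP.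
  have [z [[e Qz] nPz]] : exists z, radical (Q j) z /\ ~ P z.
    apply: contrapT => H; apply: (radQ j i nij); rewrite Pi.
    apply/seteqP; split; last exact: minP.
    by move=> z Rz; apply: contrapT => nPz; apply: H; exists z.
  by exists (z ^+ e); split=> // /(primeX HP).
exists (\prod_j w j) => [|c]; last first.
  rewrite -Ki JE => Qc j /=; have [->|nji] := eqVneq j i; first exact: idealM.
  apply: idealMr => //; rewrite (bigD1 j) //=; apply: idealMr => //.
  by apply: (Hw j).2.
elim/big_ind: _ => [|a b nPa nPb|j _]; [by case: HP| |exact: (Hw j).1].
by have [_ _ PM] := HP => /PM[].
Qed.

End PrimaryComponent.

Section MpolyInstance.

Lemma mpoly_polynomial_ring3 (R : idomainType) :
  @polynomial_ring3 R {mpoly R[3]} (@mpolyC 3 R) 'X_ord3_0 'X_ord3_1 'X_ord3_2.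
Proof.
split=> [P PC P0 P1 P2 PD PM|S f u0 u1 u2].
  by apply: mpoly_ring_ind => //; apply: ord3P.
exists (eval_mpoly f (fun i => [:: u0; u1; u2]`_i)).
by split=> [q|||]; rewrite ?eval_mpolyC ?eval_mpolyX.
Qed.

Definition ring_iso (A B : comNzRingType) : Prop :=
  exists (f : {rmorphism A -> B}) (g : {rmorphism B -> A}), cancel f g /\ cancel g f.

Lemma ring_iso_trans (A B D : comNzRingType) :
  ring_iso A B -> ring_iso B D -> ring_iso A D.
Proof.
move=> [f [g [fK gK]]] [f' [g' [fK' gK']]]; exists (f' \o f), (g \o g').
by split; apply: can_comp.
Qed.

Lemma ring_iso_poly (A B : comNzRingType) :
  ring_iso A B -> ring_iso {poly A} {poly B}.
Proof.
have mapK (A' B' : comNzRingType) (f : {rmorphism A' -> B'}) (g : {rmorphism B' -> A'}) :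
    cancel f g -> cancel (map_poly f) (map_poly g).
  by move=> fK p; rewrite -map_poly_comp; apply: map_poly_id => c _ /=; rewrite fK.
by move=> [f [g [fK gK]]]; exists (map_poly f), (map_poly g); split; apply: mapK.
Qed.

Lemma hb_cohen_macaulay_iso d (B T : idomainType) (S : comNzRingType)
    (Pi : {rmorphism T -> S}) (t c a b X Y : T) :
  good d B -> ring_iso {poly {poly B}} T -> (forall s, exists F, Pi F = s) ->
  (forall F, Pi F = 0 <-> hb_ideal t c a b X Y [set 0] F) ->
  t * X + c * Y != 0 ->
  regmod (addgen [set 0] (t * X + c * Y)) (a * X + b * Y) ->
  is_cohen_macaulay S.
Proof.
move=> gB [th [et [thK etK]]] Pi_surj kerPi fnz greg.
apply: (@hb_cohen_macaulay d B S (Pi \o th) (et t) (et c) (et a) (et b) (et X) (et Y)) => //.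
- by move=> s; have [F <-] := Pi_surj s; exists (et F); rewrite /= etK.
- move=> z; rewrite /= kerPi; split.
    by move/(hb_ideal_iso et); rewrite thK.
  by move/(hb_ideal_iso th); rewrite !etK.
- rewrite -!rmorphM -rmorphD; apply: contra_neq fnz => E.
  by rewrite -[LHS]etK E rmorph0.
move=> F; rewrite -!rmorphM -!rmorphD addgen0E => -[v E].
have : addgen [set 0] (t * X + c * Y) (th F).
  apply: greg; rewrite addgen0E; exists (th v).
  by have := congr1 th E; rewrite !(rmorphM th) !etK.
by rewrite !addgen0E => -[w Ew]; exists (et w); rewrite -rmorphM -Ew thK.
Qed.

Lemma ring_iso_mpoly3_mpoly3 (k : fieldType) :
  ring_iso {poly {poly {poly {poly {poly {poly k}}}}}} {mpoly {mpoly k[3]}[3]}.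
Proof.
apply: ring_iso_trans (mpoly3_poly_iso {mpoly k[3]}).
by do 3!apply: ring_iso_poly; apply: mpoly3_poly_iso.
Qed.

Lemma good_poly2 (k : fieldType) : good 2 {poly {poly k}}.
Proof. by do 2!apply: good_poly; apply: good_field. Qed.

(** Four is the dimension of the Rees algebra: [T] has six variables, two of which become
    integral. *)
Lemma good_poly4 (k : fieldType) : good 4 {poly {poly {poly {poly k}}}}.
Proof. by do 2!apply: good_poly; apply: good_poly2. Qed.

End MpolyInstance.

(** * The base ring k[x, y, z] *)

Section BaseRing.
Variable k : fieldType.
Local Notation R := {mpoly k[3]}.
Local Notation x := (var_x k).
Local Notation y := (var_y k).

Definition kill_x : {rmorphism R -> R} :=
  eval_mpoly (@mpolyC 3 k) (fun i => [:: 0; y; 'X_ord3_2]`_i).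
Definition kill_xy : {rmorphism R -> R} :=
  eval_mpoly (@mpolyC 3 k) (fun i => [:: 0; 0; 'X_ord3_2]`_i).

Lemma kill_xE : kill_x x = 0 /\ kill_x y = y.
Proof. by rewrite /kill_x /var_x /var_y !eval_mpolyX. Qed.

Lemma kill_xyE : kill_xy x = 0 /\ kill_xy y = 0.
Proof. by rewrite /kill_xy /var_x /var_y !eval_mpolyX. Qed.

Lemma kill_x_mod c : addgen [set 0] x (kill_x c - c).
Proof.
have H0 := is_ideal0 R; have HI := addgen_ideal x H0.
apply: eval_mpoly_mod => // [d|]; first by rewrite /kill_x eval_mpolyC subrr; apply: ideal0.
apply: ord3P; rewrite /kill_x eval_mpolyX /= ?subrr; try exact: ideal0.
by rewrite sub0r; apply: idealN => //; apply: addgen_mem.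
Qed.

Lemma kill_xy_mod c : addgen (addgen [set 0] x) y (kill_xy c - c).
Proof.
have H0 := is_ideal0 R; have H1 := addgen_ideal x H0; have HI := addgen_ideal y H1.
apply: eval_mpoly_mod => // [d|]; first by rewrite /kill_xy eval_mpolyC subrr; apply: ideal0.
apply: ord3P; rewrite /kill_xy eval_mpolyX /= ?subrr; try exact: ideal0;
  rewrite sub0r; apply: idealN => //; last exact: addgen_mem.
by apply: sub_addgen; apply: addgen_mem.
Qed.

Lemma kill_x_eq0 c : kill_x c = 0 -> exists d, c = d * x.
Proof.
move=> E; have := kill_x_mod c; rewrite E sub0r addgen0E => -[d Ed].
by exists (- d); rewrite mulNr -Ed opprK.
Qed.

Lemma kill_xy_eq0 c : kill_xy c = 0 <-> exists d e, c = d * x + e * y.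
Proof.
split=> [E|[d [e ->]]]; last first.
  by rewrite rmorphD !rmorphM kill_xyE.1 kill_xyE.2 !mulr0 addr0.
have := kill_xy_mod c; rewrite E sub0r => -[e]; rewrite addgen0E => -[d Ed].
exists (- d), (- e); rewrite -[c]opprK -[in LHS](subrK (e * y) (- c)) Ed; ring.
Qed.

Lemma kill_xy_kill_x c : kill_xy (kill_x c) = kill_xy c.
Proof.
have [d Ed] := kill_x_mod c; have /= E := subr0_eq Ed.
by apply/eqP; rewrite -subr_eq0 -rmorphB E rmorphM kill_xyE.1 mulr0.
Qed.

Lemma mpolyX_neq0 (i : 'I_3) : ('X_i : R) != 0.
Proof.
by apply/eqP => /mpolyP/(_ U_(i)%MM)/eqP; rewrite mcoeffX mcoeff0 eqxx oner_eq0.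
Qed.

Lemma kill_xy_gen_eq0 c : ideal_gen [set x; y] c <-> kill_xy c = 0.
Proof. by rewrite ideal_gen2P kill_xy_eq0. Qed.

Lemma xy_prime : is_prime (ideal_gen [set x; y]).
Proof.
split; [exact: ideal_gen_ideal| |move=> a b].
  by rewrite kill_xy_gen_eq0 rmorph1 => /eqP; rewrite oner_eq0.
rewrite !kill_xy_gen_eq0 rmorphM => /eqP; rewrite mulf_eq0.
by case/orP=> /eqP; [left|right].
Qed.

Lemma height_one_mpoly (a b c : R) :
  b != 0 -> addgen [set 0] b (a * c) -> ~ addgen [set 0] b c ->
  exists P, [/\ is_prime P, P a, P b & prime_has_height P 1].
Proof.
have [f [g [fK gK]]] := mpoly3_poly_iso k.
have [_ _ _ norm2] := good_poly2 k.
exact: (height_one_prime norm2 fK gK).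
Qed.

Lemma height_one_principal (q : R) :
  q != 0 -> kill_xy q = 0 -> exists P, [/\ is_prime P, P q & prime_has_height P 1].
Proof.
move=> nzq q0; have HI := addgen_ideal q (is_ideal0 R).
(* With multiplier [0] and element [1], it only has to be checked that [q] does not divide [1]; this
   follows from its vanishing modulo [(x, y)]. *)
have [||P [HP _ Pq htP]] := @height_one_mpoly 0 q 1 nzq; last by exists P.
  by rewrite mul0r; apply: (ideal0 HI).
rewrite addgen0E => -[d /(congr1 kill_xy)].
by rewrite rmorph1 rmorphM q0 mulr0 => /eqP; rewrite oner_eq0.
Qed.

(** * Consequences of the height condition *)

Section Height.
Variables (m : nat) (p1 p2 p3 : R).
Local Notation phi := (phi_mx m p1 p2 p3).
Local Notation Delta := (x ^+ m * p2 - y ^+ m * p1).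
Hypothesis m_gt0 : (0 < m)%N.
Hypothesis I_height : has_height (minor_ideal phi 2) 2.

Lemma no_height_one P : is_prime P -> prime_has_height P 1 ->
  ~ (P (y ^+ m * p3) /\ P (x ^+ m * p3) /\ P Delta).
Proof.
move=> HP htP [P0 [P1 P2]]; have [_ H] := I_height.
suff : (2 <= 1)%N by [].
have HPi := prime_ideal HP; have [E0 E1 E2] := signed_minorE m p1 p2 p3.
apply: (H P 1%N HP _ htP); apply: minor2_ideal_min => //; apply: ord3P; rewrite ?E0 ?E1 ?E2 //.
exact: idealN.
Qed.

(** Otherwise [Delta] and [p3], hence all the 2-minors, would lie in a common prime of height
    one. *)
Lemma Delta_mod_p3_regular : p3 != 0 -> regmod (addgen [set 0] p3) Delta.
Proof.
move=> p3nz c Hc; apply: contrapT => nc.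
have [P [HP PD P3 htP]] := height_one_mpoly p3nz Hc nc.
have HPi := prime_ideal HP.
by apply: (no_height_one HP htP); do 2?split=> //; apply: idealM.
Qed.

(** Otherwise [x] divides [p1] and [p3], and with them all three minors, [Delta] being [- y^m p1]
    modulo [x]. *)
Lemma p1_p3_mod_x : ~ (kill_x p1 = 0 /\ kill_x p3 = 0).
Proof.
move=> [/kill_x_eq0[d1 E1] /kill_x_eq0[d3 E3]].
have [P [HP Px htP]] := height_one_principal (mpolyX_neq0 _) kill_xyE.1.
have HPi := prime_ideal HP; apply: (no_height_one HP htP).
have PX q : P (q * x) by apply: idealM.
rewrite E1 E3 !mulrA; split; [exact: PX|split; first exact: PX].
apply: idealB => //; apply: idealMr => //.
by rewrite -(prednK m_gt0) exprSr; apply: PX.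
Qed.

(** For [p3 = 0] the minors generate the ideal of [Delta], an element of [(x, y)], which lies in a
    prime of height one. *)
Lemma p3_neq0 : p3 != 0.
Proof.
apply/eqP => p30.
suff [P [HP PD htP]] : exists P, [/\ is_prime P, P Delta & prime_has_height P 1].
  have HPi := prime_ideal HP; apply: (no_height_one HP htP).
  by rewrite p30 !mulr0; do ?split=> //; apply: ideal0.
have [D0|Dnz] := eqVneq Delta 0.
  have [P [HP Px htP]] := height_one_principal (mpolyX_neq0 _) kill_xyE.1.
  by exists P; split=> //; rewrite D0; apply: (ideal0 (prime_ideal HP)).
apply: height_one_principal Dnz _; rewrite rmorphB !rmorphM !rmorphXn.
by rewrite kill_xyE.1 kill_xyE.2 expr0n gtn_eqF // !mul0r subrr.
Qed.

End Height.

(** * Homogeneous components and degree in z *)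

Section Degrees.
Implicit Types (p q u v : R) (d e : nat) (mu : 'X_{1..3}).

Lemma pihomogM_homog u q d e : (e <= d)%N -> q \is e.-homog ->
  pihomog mdeg d (u * q) = pihomog mdeg (d - e) u * q.
Proof.
move=> le_ed hq; pose K := (maxn (mmeasure mdeg u) (d - e).+1).
have ltK : (d - e < K)%N by rewrite /K leq_max ltnSn orbT.
have leK : (mmeasure mdeg u <= K)%N by rewrite /K leq_maxl.
rewrite [in LHS](pihomog_partitionE leK) mulr_suml linear_sum /=.
rewrite (bigD1 (Ordinal ltK)) //= [X in _ + X]big1 ?addr0.
  by rewrite pihomog_dE // -{2}(subnK le_ed); apply: dhomogM => //; apply: pihomogP.
move=> i ne; apply: (@pihomog_ne0 _ _ _ (i + e)%N).
  apply: contraNneq ne => E; apply/eqP/val_inj => /=.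
  by rewrite -E addnK.
by apply: dhomogM => //; apply: pihomogP.
Qed.

Lemma var_homog i : ('X_i : R) \is 1.-homog.
Proof. by rewrite dhomogX; apply/eqP/mdeg1. Qed.

Lemma varX_homog (i : 'I_3) d : ('X_i : R) ^+ d \is d.-homog.
Proof. by have := dhomogMn d (var_homog i); rewrite mul1n. Qed.

(** Arbitrary coefficients can be replaced by their homogeneous components, since [p] and the powers
    of the variables are forms. *)
Lemma homog_decomposition m n eps p :
  (m <= n + eps)%N -> p \is (n + eps).-homog -> ideal_gen [set x ^+ m; y ^+ n] p ->
  exists a b, [/\ p = a * x ^+ m + b * y ^+ n, a \is (n + eps - m).-homog
    & b \is eps.-homog].
Proof.
move=> le_m hp /ideal_gen2P[u [v E]].
exists (pihomog mdeg (n + eps - m) u), (pihomog mdeg eps v).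
split; try exact: pihomogP.
rewrite -(pihomog_dE hp) E linearD /= (pihomogM_homog _ le_m (varX_homog _ m)).
by rewrite (pihomogM_homog _ (leq_addr eps n) (varX_homog _ n)) addKn.
Qed.

(** Stated on the support, the bound holds for the zero polynomial at every [d], whereas [z_degree]
    gives it the value 0 and so needs [d] positive. *)
Definition z_below d p := forall mu, mu \in msupp p -> (mu ord3_2 < d)%N.

Lemma mdeg3 mu : mdeg mu = (mu ord3_0 + mu ord3_1 + mu ord3_2)%N.
Proof.
rewrite mdegE !big_ord_recl big_ord0 addn0 addnA.
by congr (_ + _ + _)%N; congr (mu _); apply: val_inj.
Qed.

Lemma z_belowB d p q : z_below d p -> z_below d q -> z_below d (p - q).
Proof.
move=> Hp Hq mu /msuppD_le; rewrite mem_cat => /orP[/Hp //|].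
by rewrite (perm_mem (msuppN q)) => /Hq.
Qed.

Lemma z_belowD d p q : z_below d p -> z_below d q -> z_below d (p + q).
Proof. by move=> Hp Hq mu /msuppD_le; rewrite mem_cat => /orP[/Hp|/Hq]. Qed.

(** Each monomial of an element of [(x, y)] involves [x] or [y], which leaves less than the full
    degree for [z]. *)
Lemma z_below_kill d p : p \is d.-homog -> kill_xy p = 0 -> z_below d p.
Proof.
move=> /dhomogP hp /kill_xy_eq0[u [v E]] mu mup.
have <- := hp mu mup; rewrite /= mdeg3.
suff pos : (0 < mu ord3_0 + mu ord3_1)%N by rewrite -[X in (X < _)%N]add0n ltn_add2r.
have : mu \in msupp (u * x + v * y) by rewrite -E.
move=> /msuppD_le; rewrite mem_cat => /orP[] /msuppM_le /allpairsP[[m1 m2] /= [_]];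
  rewrite msuppX inE => /eqP -> ->; rewrite !mnmDE !mnm1E /= ?addn0 ?addnA.
  by rewrite addn1.
by rewrite addn1.
Qed.

Lemma z_belowM d p q : z_below d p -> z_below 1 q -> z_below d (p * q).
Proof.
move=> Hp Hq mu /msuppM_le /allpairsP[[m1 m2] /= [/Hp lt1 /Hq]].
by rewrite ltnS leqn0 => /eqP z2 ->; rewrite mnmDE z2 addn0.
Qed.

Lemma z_below1_var i e : i != ord3_2 -> z_below 1 (('X_i : R) ^+ e).
Proof.
move=> ni; elim: e => [|e IH]; last first.
  rewrite exprSr; apply: z_belowM => // mu.
  by rewrite msuppX inE => /eqP ->; rewrite mnm1E (negbTE ni).
by move=> mu; rewrite expr0 msupp1 inE => /eqP ->; rewrite mnm0E.
Qed.

Lemma z_degree_lt d p : (0 < d)%N -> z_below d p -> (z_degree p < d)%N.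
Proof.
move=> d_gt0 Hp; rewrite /z_degree big_seq; elim/big_ind: _ => // a b.
by rewrite gtn_max => -> ->.
Qed.

End Degrees.

End BaseRing.

(** * The determinantal form *)

Section DeterminantalForm.
Variables (R T : idomainType) (C : {rmorphism R -> T}) (t0 t1 t2 : T).
Hypothesis polyT : polynomial_ring3 C t0 t1 t2.
Local Notation lincomb := (lincomb C t0 t1 t2).

Definition det_form (q a1 a2 a3 b1 b2 b3 : R) : T :=
  t0 * lincomb b1 b2 b3 - C q * t1 * lincomb a1 a2 a3.

Lemma det_form_lincomb q a1 a2 a3 b1 b2 b3 :
  det_form q a1 a2 a3 b1 b2 b3 = t0 * lincomb b1 b2 b3 - t1 * lincomb (q * a1) (q * a2) (q * a3).
Proof. by rewrite /det_form /lincomb !(rmorphM C); ring. Qed.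

(** Membership of the form in [(x, y)] is exploited by applying [f] to its coefficients and giving
    values to the variables; values 0 and 1 are enough to recover the coefficients. *)
Lemma det_form_eval (f : {rmorphism R -> R}) x y q a1 a2 a3 b1 b2 b3 :
  f x = 0 -> f y = 0 ->
  (exists G H, det_form q a1 a2 a3 b1 b2 b3 = G * C x + H * C y) ->
  forall u0 u1 u2, u0 * (u0 * f b1 + u1 * f b2 + u2 * f b3) =
    f q * u1 * (u0 * f a1 + u1 * f a2 + u2 * f a3).
Proof.
move=> fx fy [G [H E]] u0 u1 u2.
have [e [eC e0 e1 e2]] := poly3_eval polyT f u0 u1 u2.
have := congr1 e E; rewrite /det_form rmorphB rmorphD !rmorphM !eC fx fy !mulr0 addr0.
rewrite /lincomb !rmorphD !rmorphM !eC e0 e1 e2.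
exact: subr0_eq.
Qed.

End DeterminantalForm.

(* [A] plays the role of the forms of a given degree. *)
Section Bihomogeneous.
Variables (R : idomainType) (A : set R).
Local Notation T := {mpoly R[3]}.
Hypotheses (A0 : A 0) (AB : forall q r, A q -> A r -> A (q - r)).

Definition coef_homog (F : T) := F \is 2.-homog /\ forall mu, A F@_mu.

Lemma coef_homogB (F G : T) : coef_homog F -> coef_homog G -> coef_homog (F - G).
Proof.
move=> [F1 F2] [G1 G2]; split; first exact: rpredB.
by move=> mu; rewrite mcoeffB; apply: AB.
Qed.

Lemma coef_homogD (F G : T) : coef_homog F -> coef_homog G -> coef_homog (F + G).
Proof.
move=> [F1 F2] [G1 G2]; split; first exact: rpredD.
move=> mu; rewrite mcoeffD -[G@_mu]opprK; apply: AB => //.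
by rewrite -sub0r; apply: AB.
Qed.

Lemma coef_homog_monomial (q : R) i j : A q -> coef_homog ('X_i * ('X_j * q%:MP)).
Proof.
move=> hq; have -> : 'X_i * ('X_j * q%:MP) = q *: 'X_[U_(i) + U_(j)] :> T.
  by rewrite mulrA mulrC mul_mpolyC mpolyXD.
split=> [|mu]; first by apply: rpredZ; rewrite dhomogX /= mdegD !mdeg1.
by rewrite mcoeffZ mcoeffX; case: eqP => _; rewrite ?mulr1 ?mulr0.
Qed.

Lemma coef_homog_lincomb i (q1 q2 q3 : R) : A q1 -> A q2 -> A q3 ->
  coef_homog ('X_i * lincomb (@mpolyC 3 R) 'X_ord3_0 'X_ord3_1 'X_ord3_2 q1 q2 q3).
Proof.
move=> h1 h2 h3; rewrite /lincomb !mulrDr.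
by do 2?apply: coef_homogD; apply: coef_homog_monomial.
Qed.

Lemma coef_homog_det_form q a1 a2 a3 b1 b2 b3 :
  A (q * a1) -> A (q * a2) -> A (q * a3) -> A b1 -> A b2 -> A b3 ->
  coef_homog (det_form (@mpolyC 3 R) 'X_ord3_0 'X_ord3_1 'X_ord3_2 q a1 a2 a3 b1 b2 b3).
Proof.
move=> *; rewrite det_form_lincomb.
by apply: coef_homogB; apply: coef_homog_lincomb.
Qed.

End Bihomogeneous.

Section Proposition.
Variable k : fieldType.
Local Notation R := {mpoly k[3]}.
Local Notation T := {mpoly R[3]}.
Local Notation x := (var_x k).
Local Notation y := (var_y k).
Variables (m n eps : nat) (p1 p2 p3 a1 a2 a3 b1 b2 b3 : R).
Local Notation phi := (phi_mx m p1 p2 p3).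
Hypotheses (n_gt0 : (0 < n)%N) (le_nm : (n <= m)%N) (eps_gt0 : (0 < eps)%N)
  (le_eps : (m <= n + eps)%N).
Hypotheses (p1E : p1 = a1 * x ^+ m + b1 * y ^+ n)
  (p2E : p2 = a2 * x ^+ m + b2 * y ^+ n) (p3E : p3 = a3 * x ^+ m + b3 * y ^+ n).
Hypotheses (a1_homog : a1 \is (n + eps - m).-homog) (a2_homog : a2 \is (n + eps - m).-homog)
  (a3_homog : a3 \is (n + eps - m).-homog) (b1_homog : b1 \is eps.-homog)
  (b2_homog : b2 \is eps.-homog) (b3_homog : b3 \is eps.-homog).

Let m_gt0 : (0 < m)%N. Proof. exact: leq_trans le_nm. Qed.

(* Some [s] outside [(x, y)] has [s y^n] in [I_1], which fails when [n < m] and all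
   the [b_i] lie in [(x, y)]. *)
Lemma component_not_all_killed :
  (n < m)%N ->
  is_primary_component (minor_ideal phi 1) (ideal_gen [set x; y])
    (ideal_gen [set x ^+ m; y ^+ n]) ->
  ~ [/\ kill_xy k b1 = 0, kill_xy k b2 = 0 & kill_xy k b3 = 0].
Proof.
move=> lt_nm comp [B1 B2 B3].
have [Q HQ|s nPs Hs] := primary_component_multiplier comp (xy_prime k).
  have HQi : is_ideal Q by case: HQ.
  move=> JQ _ /ideal_gen2P[u [v ->]]; exists (m + m)%N.
  have Qx : Q (x ^+ m) by apply: JQ; have := @minor1_mem k m p1 p2 p3 ord3_0 ord0; rewrite mxE.
  have Qy : Q (y ^+ m) by apply: JQ; have := @minor1_mem k m p1 p2 p3 ord3_1 ord0; rewrite mxE.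
  by apply: ideal_exprD => //; rewrite exprMn; apply: idealM.
(* The ideal [(x^m) + y^n (x, y)]. It contains all entries of the matrix, because [n < m] and the
   [b_i] are in [(x, y)]; cancelling [y^n] modulo [x] shows that it contains [s * y^n] only for [s]
   in [(x, y)]. *)
pose W := [set q : R | exists A w, q = A * x ^+ m + y ^+ n * w /\
  kill_xy k w = 0].
have HW : is_ideal W.
  split=> [|_ _ [A [w [-> w0]]] [A' [w' [-> w0']]]|q _ [A [w [-> w0]]]].
  - by exists 0, 0; rewrite mul0r mulr0 addr0 rmorph0.
  - by exists (A + A'), (w + w'); rewrite rmorphD w0 w0' addr0; split=> //; ring.
  - by exists (q * A), (q * w); rewrite rmorphM w0 mulr0; split=> //; ring.
have [kx ky] := kill_xyE k.
have : minor_ideal phi 1 (s * y ^+ n).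
  by apply: Hs; apply/ideal_gen2P; exists 0, 1; rewrite mul0r mul1r add0r.
suff JW : minor_ideal phi 1 `<=` W.
  move=> /JW[A [w [E w0]]]; apply: nPs; apply/kill_xy_gen_eq0.
  have /eqP : kill_x k (y ^+ n * (s - w)) = 0.
    have -> : y ^+ n * (s - w) = A * x ^+ m by rewrite mulrBr [y ^+ n * s]mulrC E; ring.
    by rewrite rmorphM rmorphXn (kill_xE k).1 expr0n gtn_eqF // mulr0.
  rewrite rmorphM rmorphXn (kill_xE k).2 mulf_eq0 expf_eq0 (negbTE (mpolyX_neq0 k _)) andbF.
  move=> /eqP/(congr1 (kill_xy k)).
  by rewrite kill_xy_kill_x rmorph0 rmorphB w0 subr0.
apply: minor1_ideal_min => //.
- by exists 1, 0; rewrite rmorph0 mul1r mulr0 addr0.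
- exists 0, (y ^+ (m - n)); rewrite rmorphXn ky expr0n gtn_eqF ?subn_gt0 // mul0r add0r.
  by rewrite -exprD subnKC.
- by exists a1, b1; rewrite p1E; split=> //; ring.
- by exists a2, b2; rewrite p2E; split=> //; ring.
- by exists a3, b3; rewrite p3E; split=> //; ring.
Qed.

Variables (T : idomainType) (C : {rmorphism R -> T}) (t0 t1 t2 : T).
Hypothesis polyT : polynomial_ring3 C t0 t1 t2.
Local Notation a := (lincomb C t0 t1 t2 a1 a2 a3).
Local Notation b := (lincomb C t0 t1 t2 b1 b2 b3).
Local Notation h := (det_form C t0 t1 t2 (y ^+ (m - n)) a1 a2 a3 b1 b2 b3).

Hypothesis I_height : has_height (minor_ideal phi 2) 2.
Hypothesis I1_component :
  is_primary_component (minor_ideal phi 1) (ideal_gen [set x; y])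
    (ideal_gen [set x ^+ m; y ^+ n]).
Hypothesis z_deg :
  m = n -> z_degree (x ^+ m * p2 - y ^+ m * p1) = eps \/ z_degree p3 = eps.

Lemma det_form_mod_xy : ~ exists G H, h = G * C x + H * C y.
Proof.
have [kx ky] := kill_xyE k.
move=> /(det_form_eval polyT kx ky).
set B1 := kill_xy k b1; set B2 := kill_xy k b2; set B3 := kill_xy k b3.
set A1 := kill_xy k a1; set A2 := kill_xy k a2; set A3 := kill_xy k a3 => H.
have := H 1 0 0; have := H 1 1 0; have := H 1 0 1.
rewrite !(mul0r, mul1r, mulr0, mulr1, addr0, add0r) => H101 H110 H100.
move: le_nm; rewrite leq_eqVlt => /orP[/eqP E|lt_nm].
  (* For [m = n] the form is [b1 t0^2 + (b2 - a1) t0 t1 + b3 t0 t2 - a2 t1^2 - a3 t1 t2]; all five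
     coefficients vanish modulo [(x, y)]. *)
  have := H 0 1 0; have := H 0 1 1; move: H110; rewrite E subnn rmorph1.
  rewrite !(mul0r, mul1r, mulr0, mulr1, addr0, add0r) => H110 H011 H010.
  have A2_0 : A2 = 0 by [].
  have A3_0 : A3 = 0 by move: H011; rewrite A2_0 add0r.
  have B3_0 : B3 = 0 by move: H101; rewrite H100 add0r.
  have B2_A1 : B2 = A1 by move: H110; rewrite H100 A2_0 addr0 add0r.
  have eps_m : (n + eps - m = eps)%N by rewrite E addKn.
  have zx d : z_below 1 (x ^+ d) by apply: z_below1_var.
  have zy d : z_below 1 (y ^+ d) by apply: z_below1_var.
  have z0 q : q \is eps.-homog -> kill_xy k q = 0 -> z_below eps q := @z_below_kill k eps q.
  move: a1_homog a2_homog a3_homog; rewrite eps_m => ha1 ha2 ha3.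
  have zp3 : (z_degree p3 < eps)%N.
    apply: z_degree_lt => //; rewrite p3E.
    by apply: z_belowD; apply: z_belowM => //; apply: z0.
  have zD : (z_degree (x ^+ m * p2 - y ^+ m * p1) < eps)%N.
    apply: z_degree_lt => //.
    (* The coefficients of [h] reappear in [Delta], multiplied by monomials free of [z]. *)
    have -> : x ^+ m * p2 - y ^+ m * p1 = a2 * (x ^+ m * x ^+ m)
        + (b2 - a1) * (x ^+ m * y ^+ m) - b1 * (y ^+ m * y ^+ m).
      by rewrite p1E p2E -E; ring.
    apply: z_belowB; [apply: z_belowD|]; apply: z_belowM; try exact: z_belowM; apply: z0 => //.
      exact: rpredB.
    by rewrite rmorphB; apply/eqP; rewrite subr_eq0; apply/eqP.
  by case: (z_deg (esym E)) => eq_eps; [move: zD|move: zp3]; rewrite eq_eps ltnn.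
(* For [n < m] the factor [y^(m-n)] is killed, so only [t0 * b] is left and every [b_i] is
   killed. *)
apply: (component_not_all_killed lt_nm I1_component).
have c0 : kill_xy k (y ^+ (m - n)) = 0 by rewrite rmorphXn ky expr0n gtn_eqF ?subn_gt0.
by move: H110 H101; rewrite H100 c0 !mul0r !add0r => H2 H3; split.
Qed.

Lemma det_form_is_det : exists N (A : 'M[T]_N), h = \det A.
Proof.
exists 2, (\matrix_(i, j) if i == 0 then if j == 0 then t0 else C (y ^+ (m - n)) * t1
   else if j == 0 then a else b).
by rewrite det_mx22 !mxE.
Qed.

Variables (S : comNzRingType) (Pi : {rmorphism T -> S}) (rho : {rmorphism T -> {poly R}}).
Hypotheses (rhoC : forall q, rho (C q) = q%:P)
  (rho0 : rho t0 = signed_minor phi ord3_0 *: 'X)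
  (rho1 : rho t1 = signed_minor phi ord3_1 *: 'X)
  (rho2 : rho t2 = signed_minor phi ord3_2 *: 'X).
Hypotheses (Pi_surj : forall s, exists F, Pi F = s)
  (Pi_kernel : forall F, Pi F = 0 <-> rho F = 0).
Variable B : idomainType.
Hypotheses (good_B : good 4 B) (T_iso : ring_iso {poly {poly B}} T).

Theorem linkage_cohen_macaulay :
  [/\ is_cohen_macaulay S, h != 0 &
    [set F | rho F = 0] = ideal_gen [set lincomb C t0 t1 t2 (x ^+ m) (y ^+ m) 0;
      lincomb C t0 t1 t2 p1 p2 p3; h]].
Proof.
have h_mod := det_form_mod_xy.
have p3nz := p3_neq0 m_gt0 I_height.
have Dreg := Delta_mod_p3_regular I_height p3nz.
have xcop := p1_p3_mod_x m_gt0 I_height.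
have [kxx kxy'] := kill_xE k; have [kxyx kxyy] := kill_xyE k.
have kxy0 : kill_x k y != 0 by rewrite kxy'; apply: mpolyX_neq0.
have x0 : x != 0 by apply: mpolyX_neq0.
have [E0 E1 E2] := signed_minorE m p1 p2 p3.
have rho0' : rho t0 = (y ^+ m * p3) *: 'X by rewrite rho0 E0.
have rho1' : rho t1 = (- (x ^+ m * p3)) *: 'X by rewrite rho1 E1.
have rho2' : rho t2 = (x ^+ m * p2 - y ^+ m * p1) *: 'X by rewrite rho2 E2.
have ker := rees_kernel polyT (kill_x_mod (k:=k)) kxx kxy0 (kill_xy_mod (k:=k)) kxyx kxyy x0
  n_gt0 le_nm p1E p2E p3E p3nz Dreg xcop h_mod rhoC rho0' rho1' rho2'.
have fnz := f_neq0 polyT y x0 le_nm.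
have greg := f_g_regular polyT (kill_x_mod (k:=k)) kxx kxy0 x0
  n_gt0 le_nm p1E p2E p3E p3nz.
have fE := f_lincomb C t0 t1 t2 x y le_nm.
have gE := g_lincomb C t0 t1 t2 p1E p2E p3E.
split.
- apply: (hb_cohen_macaulay_iso good_B T_iso Pi_surj _ fnz greg) => F.
  by rewrite Pi_kernel ker.
- apply/eqP => h0; apply: h_mod; exists 0, 0; rewrite !mul0r addr0.
  exact: h0.
apply/seteqP; split=> F.
  move/ker => [u [v [w /subr0_eq E]]]; apply/ideal_gen3P; exists u, v, w.
  by rewrite E fE gE.
move/ideal_gen3P => [u [v [w E]]]; apply/ker; exists u, v, w.
by rewrite E -fE -gE subrr.
Qed.

End Proposition.

Lemma primary_component_sub (S : comNzRingType) (J P K : set S) :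
  is_primary_component J P K -> J `<=` K.
Proof. by move=> [r [Q [[_ -> _ _] [i [_ <-]]]]] z; apply. Qed.

Lemma lincomb_mpolyE (R : idomainType) (q0 q1 q2 : R) :
  lincomb (@mpolyC 3 R) 'X_ord3_0 'X_ord3_1 'X_ord3_2 q0 q1 q2 =
  'X_ord3_0 * q0%:MP + 'X_ord3_1 * q1%:MP + 'X_ord3_2 * q2%:MP :> {mpoly R[3]}.
Proof. by []. Qed.

Lemma ideal_gen_mpolyE (R : idomainType) (A : set {mpoly R[3]}) :
  @ideal_gen ({mpoly R[3]} : idomainType) A = @ideal_gen {mpoly R[3]} A.
Proof. by []. Qed.

Theorem proposition2p7 (k : fieldType) (k_infinite : infinite_set [set: k])
    (m n eps : nat) (p1 p2 p3 : {mpoly k[3]})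
    (m_ge1 : (1 <= m)%N)
    (n_bounds : (1 <= n <= m)%N)
    (eps_bound : (maxn (m - n) 1 <= eps)%N)
    (p1_form : p1 \is (n + eps).-homog)
    (p2_form : p2 \is (n + eps).-homog)
    (p3_form : p3 \is (n + eps).-homog)
    (I_height : has_height (minor_ideal (phi_mx m p1 p2 p3) 2) 2)
    (I1_component :
       is_primary_component (minor_ideal (phi_mx m p1 p2 p3) 1)
         (ideal_gen [set var_x k; var_y k])
         (ideal_gen [set var_x k ^+ m; var_y k ^+ n]))
    (z_deg : m = n ->
       z_degree (var_x k ^+ m * p2 - var_y k ^+ m * p1) = eps \/
       z_degree p3 = eps) :
  is_cohen_macaulay (rees_algebra (minor_ideal (phi_mx m p1 p2 p3) 2)) /\
  exists h : {mpoly {mpoly k[3]}[3]},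
    is_determinantal_form eps 2 h /\
    rees_ideal (phi_mx m p1 p2 p3) =
      ideal_gen [set sym_relation (phi_mx m p1 p2 p3) ord0;
                     sym_relation (phi_mx m p1 p2 p3) ord_max; h].
Proof.
have /andP[n_gt0 le_nm] := n_bounds.
move: eps_bound; rewrite geq_max leq_subLR => /andP[le_eps eps_gt0].
have I1_sub := primary_component_sub I1_component.
have K i := I1_sub _ (@minor1_mem k m p1 p2 p3 i 1).
have := K ord3_0; have := K ord3_1; have := K ord3_2; rewrite !mxE => K3 K2 K1.
have [a1 [b1 [p1E a1h b1h]]] := homog_decomposition le_eps p1_form K1.
have [a2 [b2 [p2E a2h b2h]]] := homog_decomposition le_eps p2_form K2.
have [a3 [b3 [p3E a3h b3h]]] := homog_decomposition le_eps p3_form K3.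
pose T : idomainType := {mpoly {mpoly k[3]}[3]}.
pose rho : {rmorphism {mpoly {mpoly k[3]}[3]} -> {poly {mpoly k[3]}}} :=
  mmap (@polyC {mpoly k[3]}) (fun i => signed_minor (phi_mx m p1 p2 p3) i *: 'X).
pose rho' : {rmorphism T -> {poly {mpoly k[3]}}} := rho.
pose Pi : {rmorphism {mpoly {mpoly k[3]}[3]} ->
  rees_algebra (minor_ideal (phi_mx m p1 p2 p3) 2)} := @rees_proj k m p1 p2 p3.
pose Pi' : {rmorphism T -> rees_algebra (minor_ideal (phi_mx m p1 p2 p3) 2)} := Pi.
have T_iso : ring_iso {poly {poly {poly {poly {poly {poly k}}}} : idomainType}} T.
  exact: ring_iso_mpoly3_mpoly3.
(* The arguments are supplied in stages to keep unification tractable. *)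
have := @linkage_cohen_macaulay k m n eps p1 p2 p3 a1 a2 a3 b1 b2 b3
  n_gt0 le_nm eps_gt0 p1E p2E p3E a1h a2h a3h b1h b2h b3h.
move/(_ _ _ _ _ _ (mpoly_polynomial_ring3 {mpoly k[3]}) I_height I1_component z_deg).
move/(_ _ Pi' rho' (@rees_mapC k m p1 p2 p3)).
move/(_ (@rees_mapX k m p1 p2 p3 ord3_0) (@rees_mapX k m p1 p2 p3 ord3_1)
  (@rees_mapX k m p1 p2 p3 ord3_2)).
move/(_ (@rees_proj_surj k m p1 p2 p3) (@rees_proj_eq0 k m p1 p2 p3)).
move=> /(_ _ (good_poly4 k) T_iso)[CM h_neq0 J_E].
split; first exact: CM.
exists (det_form (@mpolyC 3 {mpoly k[3]} : {rmorphism ({mpoly k[3]} : idomainType) -> T})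
  'X_ord3_0 'X_ord3_1 'X_ord3_2 (var_y k ^+ (m - n)) a1 a2 a3 b1 b2 b3).
split; last first.
  have [S0 S1] := @sym_relationE k m p1 p2 p3.
  have e0 := lincomb_mpolyE (var_x k ^+ m) (var_y k ^+ m) 0.
  have e1 := lincomb_mpolyE p1 p2 p3.
  rewrite (etrans S0 (esym e0)) (etrans S1 (esym e1)).
  exact: (etrans J_E (ideal_gen_mpolyE _)).
split; [exact: h_neq0| |exact: det_form_is_det].
(* The factor [y^(m-n)] makes up for the difference of degree between the [a_i] and the [b_i], so
   that all coefficients of the form have degree [eps]. *)
have eps_y : (n + eps - m + (m - n) = eps)%N by rewrite addnBA // subnK // addKn.
have hy q : q \is (n + eps - m).-homog -> var_y k ^+ (m - n) * q \is eps.-homog.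
  by move=> hq; rewrite mulrC -eps_y; apply: dhomogM => //; apply: varX_homog.
have := @coef_homog_det_form {mpoly k[3]} [set q | q \is eps.-homog] (rpred0 _).
move/(_ _ _ a1 a2 a3 b1 b2 b3 (hy _ a1h) (hy _ a2h) (hy _ a3h) b1h b2h b3h).
by apply=> q r hq hr; apply: rpredB.
Qed.
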